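(* Let $q\in(0,1)$, let $\gamma>0$ be real, let $1<p<\infty$ and $\frac1p+\frac1{p'}=1$. Put $b_n=\frac{1}{[n]_q!}\prod_{i=0}^{n-1}[\gamma+i]_q$ for integers $n\ge0$. Let $\Phi=(\phi_{jk})_{j,k\in\mathbb{Z}^+_0}$ be an infinite matrix of complex numbers and put $$\psi^{(j)}_{mk}=\begin{cases}\sum_{v=k}^{m}b_{v-k}\,\phi_{jv},&0\le k\le m,\\0,&k>m,\end{cases}\qquad \psi_{jk}=\sum_{v=k}^{\infty}b_{v-k}\,\phi_{jv}.$$ Consider the conditions: (1) for every $j$: $\lim_{m\to\infty}\psi^{(j)}_{mk}$ exists for all $k$, and $\sup_{m,k}|\psi^{(j)}_{mk}|<\infty$; (2) for every $j$: $\lim_{m\to\infty}\psi^{(j)}_{mk}$ exists for all $k$, and $\sup_m\sum_{k=0}^m|\psi^{(j)}_{mk}|^{p'}<\infty$; (3) for every $j$: $\lim_{m\to\infty}\psi^{(j)}_{mk}$ exists for all $k$, and $\lim_{m\to\infty}\sum_{k=0}^m|\psi^{(j)}_{mk}|=\sum_{k=0}^\infty|\psi_{jk}|$; (4) $\sup_{J\in\mathcal Z}\sum_{k=0}^\infty\big|\sum_{j\in J}\psi_{jk}\big|<\infty$; (5) $\lim_{j\to\infty}\psi_{jk}=0$ for all $k$; (6) $\lim_{j\to\infty}\psi_{jk}$ exists for all $k$; (7) $\sup_j\sum_{k=0}^\infty|\psi_{jk}|<\infty$; (8) $\lim_{j\to\infty}\sum_{k=0}^\infty|\psi_{jk}|=0$;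 (9) $\lim_{j\to\infty}\sum_{k=0}^\infty|\psi_{jk}|=\sum_{k=0}^\infty\big|\lim_{j\to\infty}\psi_{jk}\big|$; (10) $\sup_j\sum_{k=0}^\infty|\psi_{jk}|^{p'}<\infty$; (11) $\sup_{J\in\mathcal Z}\sup_k\big|\sum_{j\in J}\psi_{jk}\big|<\infty$; (12) $\sup_{J\in\mathcal Z}\sum_{k=0}^\infty\big|\sum_{j\in J}\psi_{jk}\big|^{p'}<\infty$; (13) $\sup_{j,k}|\psi_{jk}|<\infty$. Then: - $\Phi\in(\ell_1(\nabla^{(\gamma)}_q),\ell_1)$ iff (1) and (11); $\Phi\in(\ell_1(\nabla^{(\gamma)}_q),c_0)$ iff (1), (5) and (13); $\Phi\in(\ell_1(\nabla^{(\gamma)}_q),c)$ iff (1), (6) and (13); $\Phi\in(\ell_1(\nabla^{(\gamma)}_q),\ell_\infty)$ iff (1) and (13); - $\Phi\in(\ell_p(\nabla^{(\gamma)}_q),\ell_1)$ iff (2) and (12); $\Phi\in(\ell_p(\nabla^{(\gamma)}_q),c_0)$ iff (2), (5) and (10); $\Phi\in(\ell_p(\nabla^{(\gamma)}_q),c)$ iff (2), (6) and (10); $\Phi\in(\ell_p(\nabla^{(\gamma)}_q),\ell_\infty)$ iff (2) and (10); - $\Phi\in(\ell_\infty(\nabla^{(\gamma)}_q),\ell_1)$ iff (3) and (4); $\Phi\in(\ell_\infty(\nabla^{(\gamma)}_q),c_0)$ iff (3) and (8); $\Phi\in(\ell_\infty(\nabla^{(\gamma)}_q),c)$ iff (3),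 (6) and (9); $\Phi\in(\ell_\infty(\nabla^{(\gamma)}_q),\ell_\infty)$ iff (3) and (7).
   Context: $\mathbb{Z}^+_0=\{0,1,2,\dots\}$, and all indices $j,k,m$ range over it; $\mathcal Z$ is the collection of all finite subsets of $\mathbb{Z}^+_0$; $\omega$ is the space of all complex sequences $(g_j)_{j\in\mathbb{Z}^+_0}$; $c$, $c_0$ are the spaces of convergent and null sequences. For real $x$, $[x]_q=\frac{1-q^x}{1-q}$; $[0]_q!=1$ and $[k]_q!=\prod_{i=1}^k[i]_q$. Empty products equal $1$. The $q$-difference operator $\nabla^{(\gamma)}_q:\omega\to\omega$ is $$(\nabla^{(\gamma)}_q g)_j=\sum_{k=0}^{j}(-1)^{j-k}q^{\binom{j-k}{2}}\frac{\prod_{i=0}^{j-k-1}[\gamma-i]_q}{[j-k]_q!}\,g_k,$$ and $\mathfrak X(\nabla^{(\gamma)}_q)=\{g\in\omega:\nabla^{(\gamma)}_q g\in\mathfrak X\}$. For sequence spaces $\mathfrak A,\mathfrak B$, $(\mathfrak A,\mathfrak B)$ is the set of infinite complex matrices $\Phi=(\phi_{jk})$ such that for every $g\in\mathfrak A$ the series $(\Phi g)_j=\sum_{k=0}^\infty\phi_{jk}g_k$ converges for every $j$ and $\Phi g\in\mathfrak B$. The numbers $\psi_{jk}=\lim_{m\to\infty}\psi^{(j)}_{mk}$ are well defined as soon as the limits in (1), (2) or (3) exist. Equalities of limits in (3) and (9) are equalities of finite numbers. *)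

(* Defs.v *)
From HB Require Import structures.
From mathcomp Require Import all_boot all_order all_algebra complex finmap.
From mathcomp Require Import all_classical all_reals all_analysis.
Import Order.TTheory GRing.Theory Num.Theory numFieldNormedType.Exports.

Set Implicit Arguments.
Unset Strict Implicit.
Unset Printing Implicit Defensive.

Local Open Scope classical_set_scope.
Local Open Scope complex_scope.
Local Open Scope ring_scope.

(* [normc z : R] is the real-valued modulus, whereas [`|z|] lives in [R[i]].
   The norm topology of the complex plane is carried by the alias [R[i]^o]. *)
Notation normc := ComplexField.Normc.normc.

Definition qnum (R : realType) (q x : R) : R := (1 - q `^ x) / (1 - q).

Definition qfact (R : realType) (q : R) (n : nat) : R :=
  \prod_(1 <= i < n.+1) qnum q i%:R.

Definition nabla (R : realType) (q gamma : R) (g : nat -> R[i]) : nat -> R[i] :=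
  fun j => \sum_(0 <= k < j.+1)
    ((-1) ^+ (j - k) * q ^+ 'C(j - k, 2)
      * ((\prod_(0 <= i < (j - k)%N) qnum q (gamma - i%:R))
           / qfact q (j - k)))%:C * g k.

Definition nabla_domain (R : realType) (q gamma : R) (X : set (nat -> R[i])) :
  set (nat -> R[i]) := [set g | X (nabla q gamma g)].

Definition ell (R : realType) (p : R) : set (nat -> R[i]) :=
  [set g | (\sum_(0 <= k <oo) (normc (g k) `^ p)%:E < +oo)%E].

Definition ell_infty (R : realType) : set (nat -> R[i]) :=
  [set g | (ereal_sup (range (fun k => (normc (g k))%:E)) < +oo)%E].

Definition conv_seq (R : realType) : set (nat -> R[i]) :=
  [set g | cvgn (g : nat -> R[i]^o)].

Definition null_seq (R : realType) : set (nat -> R[i]) :=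
  [set g | (g : nat -> R[i]^o) @ \oo --> (0 : R[i]^o)].

Definition mx_row_terms (R : realType) (Phi : nat -> nat -> R[i])
  (g : nat -> R[i]) (j : nat) : nat -> R[i]^o := fun k => Phi j k * g k.

Definition mx_class (R : realType) (A B : set (nat -> R[i])) :
  set (nat -> nat -> R[i]) :=
  [set Phi | forall g, A g ->
    (forall j, cvgn (series (mx_row_terms Phi g j))) /\
    B (fun j => limn (series (mx_row_terms Phi g j)))].

(* The coefficients of the inverse of [nabla q gamma]. *)
Definition bcoef (R : realType) (q gamma : R) (n : nat) : R :=
  (qfact q n)^-1 * \prod_(0 <= i < n) qnum q (gamma + i%:R).

Definition psi_part (R : realType) (q gamma : R) (Phi : nat -> nat -> R[i])
  (j m k : nat) : R[i]^o :=
  if (k <= m)%N then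
    \sum_(k <= v < m.+1) (bcoef q gamma (v - k))%:C * Phi j v
  else 0.

(* As [limn] is total, this is meaningful only when the limit exists, which
   each of [cond1], [cond2] and [cond3] asserts. *)
Definition psi (R : realType) (q gamma : R) (Phi : nat -> nat -> R[i])
  (j k : nat) : R[i]^o :=
  limn (fun m => psi_part q gamma Phi j m k).

Definition cond1 (R : realType) (q gamma : R) (Phi : nat -> nat -> R[i]) :
  Prop :=
  forall j : nat,
    (forall k, cvgn (fun m => psi_part q gamma Phi j m k)) /\
    (ereal_sup (range (fun mk : nat * nat =>
       (normc (psi_part q gamma Phi j mk.1 mk.2))%:E)) < +oo)%E.

Definition cond2 (R : realType) (q gamma p' : R) (Phi : nat -> nat -> R[i]) :
  Prop :=
  forall j : nat,
    (forall k, cvgn (fun m => psi_part q gamma Phi j m k)) /\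
    (ereal_sup (range (fun m : nat =>
       (\sum_(0 <= k < m.+1) normc (psi_part q gamma Phi j m k) `^ p')%:E))
     < +oo)%E.

(* In [cond3] and [cond9] the limit is taken in the extended reals, so the
   finiteness of its value is required separately. *)
Definition cond3 (R : realType) (q gamma : R) (Phi : nat -> nat -> R[i]) :
  Prop :=
  forall j : nat,
    [/\ forall k, cvgn (fun m => psi_part q gamma Phi j m k),
        ((\sum_(0 <= k < m.+1) normc (psi_part q gamma Phi j m k))%:E
           @[m --> \oo] -->
         (\sum_(0 <= k <oo) (normc (psi q gamma Phi j k))%:E)%E) &
        (\sum_(0 <= k <oo) (normc (psi q gamma Phi j k))%:E < +oo)%E].

Definition cond4 (R : realType) (q gamma : R) (Phi : nat -> nat -> R[i]) :
  Prop :=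
  (ereal_sup (range (fun J : {fset nat} =>
     \sum_(0 <= k <oo) (normc (\sum_(j <- J) psi q gamma Phi j k)%R)%:E))
   < +oo)%E.

Definition cond5 (R : realType) (q gamma : R) (Phi : nat -> nat -> R[i]) :
  Prop :=
  forall k : nat, psi q gamma Phi j k @[j --> \oo] --> (0 : R[i]^o).

Definition cond6 (R : realType) (q gamma : R) (Phi : nat -> nat -> R[i]) :
  Prop :=
  forall k : nat, cvgn (fun j => psi q gamma Phi j k).

Definition cond7 (R : realType) (q gamma : R) (Phi : nat -> nat -> R[i]) :
  Prop :=
  (ereal_sup (range (fun j : nat =>
     \sum_(0 <= k <oo) (normc (psi q gamma Phi j k))%:E)) < +oo)%E.

Definition cond8 (R : realType) (q gamma : R) (Phi : nat -> nat -> R[i]) :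
  Prop :=
  (\sum_(0 <= k <oo) (normc (psi q gamma Phi j k))%:E)%E @[j --> \oo] --> 0%E.

Definition cond9 (R : realType) (q gamma : R) (Phi : nat -> nat -> R[i]) :
  Prop :=
  ((\sum_(0 <= k <oo) (normc (psi q gamma Phi j k))%:E)%E @[j --> \oo] -->
   (\sum_(0 <= k <oo) (normc (limn (fun j => psi q gamma Phi j k)))%:E)%E) /\
  (\sum_(0 <= k <oo) (normc (limn (fun j => psi q gamma Phi j k)))%:E
   < +oo)%E.

Definition cond10 (R : realType) (q gamma p' : R) (Phi : nat -> nat -> R[i]) :
  Prop :=
  (ereal_sup (range (fun j : nat =>
     \sum_(0 <= k <oo) (normc (psi q gamma Phi j k) `^ p')%:E)) < +oo)%E.

Definition cond11 (R : realType) (q gamma : R) (Phi : nat -> nat -> R[i]) :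
  Prop :=
  (ereal_sup (range (fun J : {fset nat} =>
     ereal_sup (range (fun k : nat =>
       (normc (\sum_(j <- J) psi q gamma Phi j k)%R)%:E)))) < +oo)%E.

Definition cond12 (R : realType) (q gamma p' : R) (Phi : nat -> nat -> R[i]) :
  Prop :=
  (ereal_sup (range (fun J : {fset nat} =>
     \sum_(0 <= k <oo)
       (normc (\sum_(j <- J) psi q gamma Phi j k)%R `^ p')%:E)) < +oo)%E.

Definition cond13 (R : realType) (q gamma : R) (Phi : nat -> nat -> R[i]) :
  Prop :=
  (ereal_sup (range (fun jk : nat * nat =>
     (normc (psi q gamma Phi jk.1 jk.2))%:E)) < +oo)%E.

(* Main.v *)
Require Import Defs.
From HB Require Import structures.
From mathcomp Require Import all_boot all_order all_algebra complex finmap.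
From mathcomp Require Import all_classical all_reals all_analysis.
From mathcomp Require Import ring lra.
Import Order.TTheory GRing.Theory Num.Theory numFieldNormedType.Exports.
Import ComplexField.Normc.
Local Open Scope ring_scope.
Local Open Scope complex_scope.
Local Open Scope classical_set_scope.
Set Implicit Arguments.
Unset Strict Implicit.
Unset Printing Implicit Defensive.

(** The substitution [h = nabla g] removes the difference operator. The operator is
    a lower triangular Toeplitz matrix with generating function
    [(x; q)_oo / (q^gamma x; q)_oo], and by the q-binomial theorem the reciprocal
    series has the coefficients [bcoef] ([nabla_coef_bcoef]). The domain of [X] is
    therefore the set of the Cauchy products of [bcoef] with the elements [h] of [X],
    and an interchange of finite sums turns the partial sums of the j-th row of
    [Phi g] into [sum_(k <= m) psi_part j m k * h k] ([pairing_psi_part]). So [Phi]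
    belongs to the class exactly when, for each [j], the row-finite matrix
    [psi_part j] maps [X] into the convergent sequences, and the matrix [psi] of the
    limits of the columns of these matrices maps [X] into [Y] ([mx_class_psiP]).

    Both halves are questions about matrix maps from [l_1], [l_p] or [l_oo], and the
    first one is an instance of the case of convergent images of the second. For
    bounded images the answer is [uniform_boundedness]: the rows must be bounded in
    the dual space. For images in [l_1] it is applied to the finite sums of rows,
    which control [sum_j |(A h) j|] up to a factor 4 ([summable_image]). For
    convergent or null images on [l_1] and [l_p], where truncations are dense,
    convergence of the columns has to be added to boundedness of the rows
    ([sectional_convergent_image]). On [l_oo] truncations are not dense; there
    [schur] shows that the rows must converge in the norm of [l_1]
    ([bounded_convergent_image]), which, given convergence of the columns, is the
    same as convergence of the norms of the rows to that of the limit ([scheffe]).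

    The explicit forms of the conditions come from the description of the dual of
    [l_1] and of [l_oo], and from Young's inequality together with its equality case
    for [l_p] ([young_sum], [lp_norming]). *)

Local Notation Re := complex.Re.
Local Notation Im := complex.Im.

(** * Complex sequences *)

Lemma cvgn_sum (K : numFieldType) (W : normedModType K) (I : Type) (r : seq I)
    (f : I -> nat -> W) (g : I -> W) :
  (forall i, f i @ \oo --> g i) ->
  (fun n => \sum_(i <- r) f i n) @ \oo --> \sum_(i <- r) g i.
Proof.
move=> fg; elim: r => [|i r ih].
  by rewrite big_nil; under eq_fun do rewrite big_nil; exact: cvg_cst.
rewrite big_cons; under eq_fun do rewrite big_cons.
by apply: cvgD; [exact: fg|exact: ih].
Qed.

Section ComplexSequences.
Variable R : realType.
Implicit Types (z l : R[i]) (u w : nat -> R[i]).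

Lemma normc_ge0 z : 0 <= normc z.
Proof. by case: z => a b; exact: sqrtr_ge0. Qed.

Lemma normC_normc z : `|z| = (normc z)%:C.
Proof. by case: z. Qed.

Lemma normcD z l : normc (z + l) <= normc z + normc l.
Proof. exact: le_normcD. Qed.

Lemma normcB z l : normc (z - l) <= normc z + normc l.
Proof. by rewrite -(normcN l) normcD. Qed.

Lemma normc_dist z l : normc (z - l) = normc (l - z).
Proof. by rewrite -(normcN (z - l)) opprB. Qed.

Lemma normc_real (a : R) : normc a%:C = `|a|.
Proof. by rewrite /= expr0n /= addr0 sqrtr_sqr. Qed.

Lemma normc_sum (I : Type) (r : seq I) (P : pred I) (F : I -> R[i]) :
  normc (\sum_(i <- r | P i) F i) <= \sum_(i <- r | P i) normc (F i).
Proof.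
elim/big_ind2 : _ => [|x a y b xa yb|//]; first by rewrite normc0.
by rewrite (le_trans (normcD _ _))// lerD.
Qed.

Lemma ler_Re_normc z : `|Re z| <= normc z.
Proof. by case: z => a b /=; rewrite -sqrtr_sqr ler_wsqrtr// lerDl sqr_ge0. Qed.

Lemma ler_Im_normc z : `|Im z| <= normc z.
Proof. by case: z => a b /=; rewrite -sqrtr_sqr ler_wsqrtr// lerDr sqr_ge0. Qed.

Lemma normc_le_ReIm z : normc z <= `|Re z| + `|Im z|.
Proof.
case: z => a b /=; rewrite -[leRHS]ger0_norm ?addr_ge0// -sqrtr_sqr.
rewrite ler_wsqrtr// sqrrD !real_normK ?num_real//.
by rewrite lerD2r lerDl mulrn_wge0// mulr_ge0.
Qed.

Lemma Re_sum (I : Type) (r : seq I) (P : pred I) (F : I -> R[i]) :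
  Re (\sum_(i <- r | P i) F i) = \sum_(i <- r | P i) Re (F i).
Proof. exact: (raddf_sum (@Re R : Rcomplex R -> R)). Qed.

Lemma Im_sum (I : Type) (r : seq I) (P : pred I) (F : I -> R[i]) :
  Im (\sum_(i <- r | P i) F i) = \sum_(i <- r | P i) Im (F i).
Proof. exact: (raddf_sum (@Im R : Rcomplex R -> R)). Qed.

(** The conjugate of the usual sign, so that multiplication by it turns [z] into
    its modulus; it is [0] at [0]. *)
Definition phase z : R[i] := (normc z)%:C / z.

Lemma phaseM z : phase z * z = (normc z)%:C.
Proof.
rewrite /phase; have [->|z0] := eqVneq z 0; first by rewrite mulr0 normc0.
by rewrite mulfVK.
Qed.

Lemma normc_phase z : normc (phase z) <= 1.
Proof.
rewrite /phase normcM normcV normc_real ger0_norm ?normc_ge0//.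
by have [->|z0] := eqVneq (normc z) 0; rewrite ?mul0r ?divff.
Qed.

Lemma cvg_normcP u l :
  (u : nat -> R[i]^o) @ \oo --> (l : R[i]^o) <->
  (forall e : R, 0 < e ->
     exists N, forall n, (N <= n)%N -> normc (l - u n) < e).
Proof.
split=> [/cvgrPdist_lt ul e e0|ul].
  have /ul[N _ H] : 0 < e%:C by rewrite ltcR.
  by exists N => n /H /=; rewrite normC_normc ltcR.
apply/cvgrPdist_lt => -[e e']; rewrite ltcE/= => /andP[/eqP -> e0].
have [N H] := ul _ e0; exists N => // n /H.
by rewrite /= normC_normc -ltcR.
Qed.

Lemma normc_cvg u l : (u : nat -> R[i]^o) @ \oo --> (l : R[i]^o) ->
  (fun n => normc (u n)) @ \oo --> normc l.
Proof.
move=> /cvg_normcP ul; apply/cvgrPdist_lt => e /ul[N H]; exists N => // n /H.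
apply: le_lt_trans; have := normcD (l - u n) (u n); have := normcD (u n - l) l.
by rewrite !subrK (normc_dist (u n)) ler_norml; lra.
Qed.

Lemma normc_lim_le u l (M : R) N : (u : nat -> R[i]^o) @ \oo --> (l : R[i]^o) ->
  (forall n, (N <= n)%N -> normc (u n) <= M) -> normc l <= M.
Proof.
move=> /normc_cvg ul uM; rewrite -(cvg_lim _ ul)//.
by apply: limr_le; [exact: cvgP ul|exists N => // n; exact: uM].
Qed.

Lemma cvg_ReIm u (a b : R) : (fun n => Re (u n)) @ \oo --> a ->
  (fun n => Im (u n)) @ \oo --> b ->
  (u : nat -> R[i]^o) @ \oo --> (a +i* b : R[i]^o).
Proof.
move=> /cvgrPdist_lt ua /cvgrPdist_lt ub; apply/cvg_normcP => e e0.
have e20 : 0 < e / 2 by rewrite divr_gt0.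
have [N1 _ H1] := ua _ e20; have [N2 _ H2] := ub _ e20.
exists (maxn N1 N2) => n; rewrite geq_max => /andP[/H1 h1 /H2 h2].
apply: (le_lt_trans (normc_le_ReIm _)).
rewrite (splitr e) ltrD//; move: h1 h2; case: (u n) => //=.
Qed.

(** The real and the imaginary part are absolutely convergent real series. *)
Lemma abs_summable_cvg u (M : R) :
  (forall n, \sum_(0 <= k < n) normc (u k) <= M) ->
  cvgn (series (u : nat -> R[i]^o)).
Proof.
move=> uM.
have real_cvg (v : nat -> R) : (forall k, `|v k| <= normc (u k)) ->
    cvgn (series v).
  move=> vu; apply: normed_cvg; apply: nondecreasing_is_cvgn.
    by apply: nondecreasing_series => // n _ _; exact: normr_ge0.
  exists M => _ [n _ <-]; apply: le_trans (uM n).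
  by rewrite /series/=; apply: ler_sum.
have /cvg_ex[a ua] := real_cvg _ (fun k => ler_Re_normc (u k)).
have /cvg_ex[b ub] := real_cvg _ (fun k => ler_Im_normc (u k)).
apply: (@cvgP _ _ (a +i* b : R[i]^o)).
apply: cvg_ReIm.
  rewrite (_ : (fun n => Re _) = series (fun k => Re (u k)))//.
  by apply/funext => n; rewrite /series/= Re_sum.
rewrite (_ : (fun n => Im _) = series (fun k => Im (u k)))//.
by apply/funext => n; rewrite /series/= Im_sum.
Qed.

Lemma cvgcD u w l z : (u : nat -> R[i]^o) @ \oo --> (l : R[i]^o) ->
  (w : nat -> R[i]^o) @ \oo --> (z : R[i]^o) ->
  (fun n => u n + w n : R[i]^o) @ \oo --> (l + z : R[i]^o).
Proof. by move=> ul wz; apply: cvgD; [exact: ul|exact: wz]. Qed.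

Lemma cvgcB u w l z : (u : nat -> R[i]^o) @ \oo --> (l : R[i]^o) ->
  (w : nat -> R[i]^o) @ \oo --> (z : R[i]^o) ->
  (fun n => u n - w n : R[i]^o) @ \oo --> (l - z : R[i]^o).
Proof. by move=> ul wz; apply: cvgB; [exact: ul|exact: wz]. Qed.

Lemma cvgcM u w l z : (u : nat -> R[i]^o) @ \oo --> (l : R[i]^o) ->
  (w : nat -> R[i]^o) @ \oo --> (z : R[i]^o) ->
  (fun n => u n * w n : R[i]^o) @ \oo --> (l * z : R[i]^o).
Proof. by move=> ul wz; apply: cvgM; [exact: ul|exact: wz]. Qed.

Lemma cvgn_eventually_cst u l N : (forall n, (N <= n)%N -> u n = l) ->
  (u : nat -> R[i]^o) @ \oo --> (l : R[i]^o).
Proof.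
move=> ul; apply: cvg_near_cst; exists N => // n /= Nn; exact: ul.
Qed.

Lemma cvgn_normc_bounded u : cvgn (u : nat -> R[i]^o) ->
  exists M, forall n, normc (u n) <= M.
Proof.
move=> /cvg_ex[l /normc_cvg ul]; have /cvg_seq_bounded[M [_ uM]] := cvgP _ ul.
by exists (M + 1) => n; rewrite -[leLHS]ger0_norm ?normc_ge0// uM ?ltrDl.
Qed.

Lemma nonneg_series_tail (f : nat -> R) (M : R) : (forall k, 0 <= f k) ->
  (forall n, \sum_(0 <= k < n) f k <= M) ->
  forall e, 0 < e -> exists N, forall m, \sum_(N <= k < m) f k <= e.
Proof.
move=> f0 fM e e0; pose S := range (fun n => \sum_(0 <= k < n) f k).
have S_sup : has_sup S.
  by split; [exists (\sum_(0 <= k < 0) f k), 0%N|exists M => _ [n _ <-]].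
have [_ [N _ <-] SN] := sup_adherent e0 S_sup; exists N => m.
have [Nm|/ltnW mN] := leqP N m; last by rewrite big_geq// ltW.
have : \sum_(0 <= k < m) f k <= sup S by apply: ub_le_sup; [case: S_sup|exists m].
by rewrite (big_cat_nat (leq0n N) Nm)/=; lra.
Qed.

End ComplexSequences.

(** * Solid sequence spaces and their duals *)

Definition pairing (R : realType) (a x : nat -> R[i]) : R[i]^o :=
  limn (series (fun k => a k * x k : R[i]^o)).

Lemma pairing_lim (R : realType) (a x : nat -> R[i]) (l : R[i]^o) :
  series (fun k => a k * x k : R[i]^o) @ \oo --> l -> pairing a x = l.
Proof. exact: cvg_lim. Qed.

Section SolidBalls.
Variables (R : realType) (V : set (nat -> R)).
Implicit Types (a x y : nat -> R[i]) (M r : R).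

(** The spaces in play are those of the [x] for which [sum_k v k * |x k|] is
    bounded uniformly in [v \in V], for a set [V] of nonnegative weights: [V] is
    the constant [1] for [l_1], the unit vectors for [l_oo], and the nonnegative
    part of the unit ball of the conjugate space for [l_p]. A norm defined in this
    way is subadditive, lower semicontinuous for coordinatewise convergence, and
    depends on the moduli of the coordinates alone. It is used through its balls,
    which avoids infinite values. *)
Definition ball_of x M := forall v n, V v ->
  \sum_(0 <= k < n) v k * normc (x k) <= M.

Definition space_of : set (nat -> R[i]) := [set x | exists M, ball_of x M].

(** The ball of radius [M] of the Koethe dual, that is, [M] bounds the norm of [a]
    as a functional on the space. *)
Definition dual_ball_of a M := forall x, ball_of x 1 ->
  forall n, \sum_(0 <= k < n) normc (a k) * normc (x k) <= M.

(** These normalizations make the coordinate functionals and the unit vectors have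
    norm at most [1]. *)
Definition weights :=
  (forall v k, V v -> 0 <= v k <= 1) /\ (forall k, exists2 v, V v & 1 <= v k).

Hypothesis V_weights : weights.

Let V_ge0 v k : V v -> 0 <= v k.
Proof. by move=> Vv; case/andP: (V_weights.1 v k Vv). Qed.

Lemma ball_coord x M k : ball_of x M -> normc (x k) <= M.
Proof.
have [v Vv v1] := V_weights.2 k; move=> /(_ v k.+1 Vv); apply: le_trans.
rewrite big_nat_recr//= -[leLHS]add0r lerD//.
  by apply: sumr_ge0 => i _; rewrite mulr_ge0 ?normc_ge0 ?V_ge0.
by rewrite ler_peMl ?normc_ge0.
Qed.

Lemma ball_ge0 x M : ball_of x M -> 0 <= M.
Proof. by move/(ball_coord 0); apply: le_trans; exact: normc_ge0. Qed.

Lemma ball_le x M r : M <= r -> ball_of x M -> ball_of x r.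
Proof. by move=> Mr xM v n Vv; apply: le_trans Mr; exact: xM. Qed.

Lemma ball_solid x y M : (forall k, normc (y k) <= normc (x k)) ->
  ball_of x M -> ball_of y M.
Proof.
move=> yx xM v n Vv; apply: le_trans (xM v n Vv).
by apply: ler_sum => k _; rewrite ler_wpM2l ?V_ge0.
Qed.

Lemma ball0 : ball_of (fun=> 0) 0.
Proof. by move=> v n _; rewrite big1// => k _; rewrite normc0 mulr0. Qed.

Lemma ballD x y M r : ball_of x M -> ball_of y r ->
  ball_of (fun k => x k + y k) (M + r).
Proof.
move=> xM yr v n Vv; apply: le_trans (lerD (xM v n Vv) (yr v n Vv)).
rewrite -big_split/=; apply: ler_sum => k _.
by rewrite -mulrDr ler_wpM2l ?V_ge0 ?normcD.
Qed.

Lemma ballZ (c : R[i]) x M : ball_of x M ->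
  ball_of (fun k => c * x k) (normc c * M).
Proof.
move=> xM v n Vv; under eq_bigr do rewrite normcM mulrCA.
by rewrite -mulr_sumr ler_wpM2l ?normc_ge0 ?xM.
Qed.

Lemma ball_delta i : ball_of (fun k => (k == i)%:R) 1.
Proof.
move=> v n Vv; apply: (@le_trans _ _ (\sum_(0 <= k < n | k == i) 1)).
  rewrite [leRHS]big_mkcond/=; apply: ler_sum => k _.
  case: eqP => _; last by rewrite normc0 mulr0.
  by rewrite normc1 mulr1; case/andP: (V_weights.1 _ k Vv).
by rewrite big_nat1_eq; case: ifP.
Qed.

Lemma ball_lim (u : nat -> nat -> R[i]) x M :
  (forall k, (u^~ k : nat -> R[i]^o) @ \oo --> (x k : R[i]^o)) ->
  (forall m, ball_of (u m) M) -> ball_of x M.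
Proof.
move=> ux uM v n Vv.
have cv : (fun m => \sum_(0 <= k < n) v k * normc (u m k)) @ \oo -->
    \sum_(0 <= k < n) v k * normc (x k).
  by apply: cvgn_sum => k; apply: cvgMr; exact: normc_cvg.
rewrite -(cvg_lim _ cv)//; apply: limr_le; first exact: cvgP cv.
by apply: nearW => m; exact: uM.
Qed.

Lemma space_ball x : space_of x -> exists2 r, 0 < r & ball_of x r.
Proof.
move=> [M xM]; exists (M + 1); first by rewrite ltr_wpDl// (ball_ge0 xM).
by apply: ball_le xM; rewrite lerDl.
Qed.

Lemma dual_pair a x M r : dual_ball_of a M -> 0 < r -> ball_of x r ->
  forall n, \sum_(0 <= k < n) normc (a k) * normc (x k) <= M * r.
Proof.
move=> aM r0 xr n.
have /(aM _) /(_ n) : ball_of (fun k => (r^-1)%:C * x k) 1.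
  rewrite -(mulVf (lt0r_neq0 r0)).
  have := ballZ (r^-1)%:C xr; rewrite normc_real ger0_norm//.
  by rewrite invr_ge0 ltW.
under eq_bigr do rewrite normcM normc_real mulrCA.
by rewrite -mulr_sumr ger0_norm ?invr_ge0 ?(ltW r0)// ler_pdivrMl// mulrC.
Qed.

Lemma dual_ge0 a M : dual_ball_of a M -> 0 <= M.
Proof.
move=> /(_ (fun=> 0)) /(_ _ 0); rewrite big_geq//; apply.
by apply: ball_le ball0.
Qed.

Lemma dual_le a M r : M <= r -> dual_ball_of a M -> dual_ball_of a r.
Proof. by move=> Mr aM x x1 n; apply: le_trans Mr; exact: aM. Qed.

Lemma pairing_cvg a x M : dual_ball_of a M -> space_of x ->
  series (fun k => a k * x k : R[i]^o) @ \oo --> pairing a x.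
Proof.
move=> aM /space_ball[r r0 xr]; apply: (@abs_summable_cvg _ _ (M * r)) => n.
by under eq_bigr do rewrite normcM; exact: dual_pair.
Qed.

Lemma pairing_le a x M r : dual_ball_of a M -> 0 < r -> ball_of x r ->
  normc (pairing a x) <= M * r.
Proof.
move=> aM r0 xr; have /(normc_lim_le (N := 0)) := pairing_cvg aM (ex_intro _ r xr).
apply=> n _; rewrite /series/=; apply: le_trans (normc_sum _ _ _) _.
by under eq_bigr do rewrite normcM; exact: dual_pair.
Qed.

Lemma pairingD a x y M : dual_ball_of a M -> space_of x -> space_of y ->
  pairing a (fun k => x k + y k) = pairing a x + pairing a y.
Proof.
move=> aM /(pairing_cvg aM) xM /(pairing_cvg aM) yM; apply: pairing_lim.
rewrite (_ : series _ = fun n =>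
    series (fun k => a k * x k) n + series (fun k => a k * y k) n).
  exact: cvgcD xM yM.
apply/funext => n; rewrite /series/= -big_split/=.
by apply: eq_bigr => k _; rewrite mulrDr.
Qed.

Lemma pairingZ a x (c : R[i]) M : dual_ball_of a M -> space_of x ->
  pairing a (fun k => c * x k) = c * pairing a x.
Proof.
move=> aM /(pairing_cvg aM) xM; apply: pairing_lim.
rewrite (_ : series _ = fun n => c * series (fun k => a k * x k) n).
  by apply: cvgcM; [exact: cvg_cst|exact: xM].
apply/funext => n; rewrite /series/= mulr_sumr.
by apply: eq_bigr => k _; rewrite mulrCA.
Qed.

Lemma spaceZ x (c : R[i]) : space_of x -> space_of (fun k => c * x k).
Proof. by move=> [M xM]; exists (normc c * M); exact: ballZ. Qed.

Lemma pairing_fin a x n : (forall k, (n <= k)%N -> a k * x k = 0) ->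
  pairing a x = \sum_(0 <= k < n) a k * x k.
Proof.
move=> ax0; apply: pairing_lim; apply: (@cvgn_eventually_cst _ _ _ n) => m nm.
rewrite /series/= (big_cat_nat (leq0n n) nm)/= [X in _ + X]big_nat_cond.
by rewrite [X in _ + X]big1 ?addr0// => k /andP[/andP[nk _] _]; exact: ax0.
Qed.

(** Turning and truncating [x] makes all the products [a k * x k] with [k < n]
    nonnegative and kills the others; the ball is solid, so this costs
    nothing. *)
Lemma dual_ball_pairing a M :
  (forall x, ball_of x 1 -> normc (pairing a x) <= M) -> dual_ball_of a M.
Proof.
move=> aM x x1 n.
pose y k := if (k < n)%N then phase (a k * x k) * x k else 0.
have y1 : ball_of y 1.
  apply: ball_solid x1 => k; rewrite /y; case: ifP; rewrite ?normc0 ?normc_ge0//.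
  by rewrite normcM ler_piMl ?normc_ge0 ?normc_phase.
apply: le_trans (aM _ y1); rewrite (@pairing_fin _ _ n); last first.
  by move=> k nk; rewrite /y ltnNge nk/= mulr0.
rewrite [X in normc X](_ : _ = (\sum_(0 <= k < n) normc (a k) * normc (x k))%:C).
  by rewrite normc_real ler_norm.
rewrite rmorph_sum/= big_nat [RHS]big_nat; apply: eq_bigr => k /andP[_ kn].
by rewrite /y kn mulrCA phaseM normcM.
Qed.

Lemma pairing_delta a i : pairing a (fun k => (k == i)%:R) = a i.
Proof.
rewrite (@pairing_fin _ _ i.+1) => [|k]; last first.
  by case: eqP => [->|_]; rewrite ?ltnn ?mulr0.
rewrite big_nat_recr//= eqxx mulr1 big_nat big1 ?add0r// => k /andP[_ ki].
by rewrite lt_eqF ?mulr0.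
Qed.

Lemma dual_coord a M k : dual_ball_of a M -> normc (a k) <= M.
Proof.
move=> aM; rewrite -(pairing_delta a k) -(mulr1 M).
exact: (pairing_le aM ltr01 (ball_delta k)).
Qed.

Lemma dual_fin a n : (forall k, (n <= k)%N -> a k = 0) ->
  dual_ball_of a (\sum_(0 <= k < n) normc (a k)).
Proof.
move=> a0; apply: dual_ball_pairing => x x1; rewrite (@pairing_fin _ _ n).
  apply: le_trans (normc_sum _ _ _) _; apply: ler_sum => k _.
  by rewrite normcM ler_piMr ?normc_ge0// (ball_coord _ x1).
by move=> k /a0 ->; rewrite mul0r.
Qed.

Lemma dual_lim (u : nat -> nat -> R[i]) a M :
  (forall k, (u^~ k : nat -> R[i]^o) @ \oo --> (a k : R[i]^o)) ->
  (forall m, dual_ball_of (u m) M) -> dual_ball_of a M.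
Proof.
move=> ua uM x x1 n.
have cv : (fun m => \sum_(0 <= k < n) normc (u m k) * normc (x k)) @ \oo -->
    \sum_(0 <= k < n) normc (a k) * normc (x k).
  by apply: cvgn_sum => k; apply: cvgMl; exact: normc_cvg.
rewrite -(cvg_lim _ cv)//; apply: limr_le; first exact: cvgP cv.
by apply: nearW => m; exact: uM.
Qed.

Lemma dualD a b M r : dual_ball_of a M -> dual_ball_of b r ->
  dual_ball_of (fun k => a k + b k) (M + r).
Proof.
move=> aM br x x1 n; apply: le_trans (lerD (aM x x1 n) (br x x1 n)).
rewrite -big_split/=; apply: ler_sum => k _.
by rewrite -mulrDl ler_wpM2r ?normc_ge0 ?normcD.
Qed.

Lemma dual_ball_sum (A : nat -> nat -> R[i]) (s : seq nat) :
  (forall j, exists M, dual_ball_of (A j) M) ->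
  exists M, dual_ball_of (fun k => \sum_(j <- s) A j k) M.
Proof.
move=> AM; elim: s => [|j s [M ih]].
  by exists 0 => x x1 n; rewrite big1// => k _; rewrite big_nil normc0 mul0r.
have [r jr] := AM j; exists (r + M).
by under eq_fun do rewrite big_cons; exact: dualD.
Qed.

Lemma pairing_sum (A : nat -> nat -> R[i]) (s : seq nat) x :
  (forall j, exists M, dual_ball_of (A j) M) -> space_of x ->
  pairing (fun k => \sum_(j <- s) A j k) x = \sum_(j <- s) pairing (A j) x.
Proof.
move=> AM xX; apply: pairing_lim.
rewrite (_ : series _ = fun n =>
    \sum_(j <- s) series (fun k => A j k * x k) n).
  by apply: cvgn_sum => j; have [M jM] := AM j; exact: pairing_cvg jM xX.
apply/funext => n; rewrite /series/= exchange_big/=; apply: eq_bigr => k _.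
by rewrite mulr_suml.
Qed.

End SolidBalls.

(** * Uniform boundedness *)

Section UniformBoundedness.
Variables (R : realType) (V : set (nat -> R)).
Hypothesis V_weights : weights V.
Local Notation ball := (ball_of V).
Local Notation dual := (dual_ball_of V).

(** The factor [2 / 3] leaves room for the perturbation of relative size [1 / 2] made
    in the next proof. *)
Lemma pairing_norming (a : nat -> R[i]) (M K : R) :
  dual a M -> ~ dual a K -> 0 <= K ->
  exists u s, [/\ ball u 1, K <= s,
    forall x r, 0 < r -> ball x r -> normc (pairing a x) <= s * r &
    2 / 3 * s <= normc (pairing a u)].
Proof.
move=> aM aK K0; pose S := [set normc (pairing a x) | x in ball^~ 1].
have S_sup : has_sup S.
  split.
    exists (normc (pairing a (fun=> 0))); apply: imageP.
    by apply: (ball_le ler01); exact: ball0.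
  by exists M => _ [x x1 <-]; rewrite -(mulr1 M) (pairing_le V_weights).
have Sub x : ball x 1 -> normc (pairing a x) <= sup S.
  by move=> x1; apply: ub_le_sup; [case: S_sup|exists x].
have S_dual : dual a (sup S) by exact: (dual_ball_pairing V_weights).
have KS : K < sup S.
  by rewrite ltNge; apply/negP => SK; apply: aK; exact: dual_le S_dual.
have S0 : 0 < sup S by exact: le_lt_trans KS.
have [_ [u u1 <-] Su] := sup_adherent (divr_gt0 S0 (ltr0n R 3)) S_sup.
exists u, (sup S); split => //; first exact: ltW.
  by move=> x r r0 xr; exact: (pairing_le V_weights S_dual r0 xr).
by apply: ltW; lra.
Qed.

(** The Banach-Steinhaus theorem, by Sokal's argument. If the norms are unbounded,
    pick functionals [T n] of norm [s n >= n * 3 ^ n] and unit vectors [u n] with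
    [|T n (u n)| >= 2 / 3 * s n]. For one choice of the sign of the n-th step
    [3 ^- n * u n], the n-th functional is at least [2 / 3 * 3 ^- n * s n] at the
    sum [X n.+1] of the steps taken so far. The steps not yet taken have total norm
    at most [3 ^- n / 2], so the value at the sum of all steps still has modulus
    at least [3 ^- n * s n / 6 >= n / 6], which is not bounded. *)
Theorem uniform_boundedness (I : Type) (a : I -> nat -> R[i]) :
  (forall i, exists M, dual (a i) M) ->
  (forall x, space_of V x ->
    exists N, forall i, normc (pairing (a i) x) <= N) ->
  exists M, forall i, dual (a i) M.
Proof.
move=> a_dual a_ptw; apply: contrapT => /forallNP unbdd.
pose e (n : nat) : R := 3^-1 ^+ n.
have e_gt0 n : 0 < e n by rewrite exprn_gt0// invr_gt0.
have eS n : e n.+1 = e n / 3 by rewrite /e exprS mulrC.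
have /choice[f fP] : forall n, exists f : I * (nat -> R[i]) * R,
    let: (i, u, s) := f in [/\ ball u 1, n%:R / e n <= s,
    forall x r, 0 < r -> ball x r -> normc (pairing (a i) x) <= s * r &
    2 / 3 * s <= normc (pairing (a i) u)].
  move=> n; have /existsNP[i ai] := unbdd (n%:R / e n).
  have [M aM] := a_dual i.
  have [|u [s us]] := @pairing_norming _ _ _ aM ai.
    by rewrite divr_ge0// ltW.
  by exists (i, u, s).
pose T n := pairing (a (f n).1.1); pose u n := (f n).1.2; pose s n := (f n).2.
have u1 n : ball (u n) 1.
  by have := fP n; rewrite /u; case: (f n) => [[i w] t] [].
have s_ge n : n%:R / e n <= s n.
  by have := fP n; rewrite /s; case: (f n) => [[i w] t] [].
have T_le n x r : 0 < r -> ball x r -> normc (T n x) <= s n * r.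
  by have := fP n; rewrite /s /T; case: (f n) => [[i w] t] /= [_ _ + _]; apply.
have T_ge n : 2 / 3 * s n <= normc (T n (u n)).
  by have := fP n; rewrite /s /T /u; case: (f n) => [[i w] t] /= [].
have TD n x y : space_of V x -> space_of V y ->
    T n (fun k => x k + y k) = T n x + T n y.
  by rewrite /T; have [M aM] := a_dual (f n).1.1; exact: (pairingD V_weights aM).
have TZ n (c : R[i]) x : space_of V x -> T n (fun k => c * x k) = c * T n x.
  by rewrite /T; have [M aM] := a_dual (f n).1.1; exact: (pairingZ V_weights c aM).
(* If both signs gave a small value at [x +- e n * u n], so would their half
   difference, which is [e n * u n]. *)
pose next n (x : nat -> R[i]) :=
  if 2 / 3 * (e n * s n) <= normc (T n (fun k => x k + (e n)%:C * u n k))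
  then fun k => (e n)%:C * u n k else fun k => (- (e n)%:C) * u n k.
have next_ball n x : ball (next n x) (e n).
  have e_norm : `|e n| * 1 = e n by rewrite mulr1 ger0_norm// ltW.
  rewrite /next; case: ifP => _.
    by have := ballZ (e n)%:C (u1 n); rewrite normc_real e_norm.
  by have := ballZ (- (e n)%:C) (u1 n); rewrite normcN normc_real e_norm.
pose X := fix X n : nat -> R[i] :=
  if n is m.+1 then fun k => X m k + next m (X m) k else fun=> 0.
have XB n d : ball (fun k => X (n + d)%N k - X n k)
    (3 / 2 * (e n - e (n + d)%N)).
  elim: d => [|d ih].
    rewrite addn0 subrr mulr0.
    by under eq_fun do rewrite subrr; exact: ball0.
  rewrite addnS /=.
  under eq_fun do rewrite addrAC.
  rewrite eS; apply: ball_le (ballD V_weights ih (next_ball (n + d)%N _)).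
  by rewrite le_eqVlt; apply/orP; left; apply/eqP; field.
have XB' n d : ball (fun k => X (n + d)%N k - X n k) (3 / 2 * e n).
  by apply: ball_le (XB n d); have := e_gt0 (n + d)%N; have := e_gt0 n; nra.
have X_space n : space_of V (X n).
  exists (3 / 2 * e 0); have := XB' 0%N n; rewrite add0n.
  by congr ball; apply/funext => k; rewrite subr0.
have TX n : 2 / 3 * (e n * s n) <= normc (T n (X n.+1)).
  have uX : space_of V (u n) by exists 1.
  rewrite /= /next; case: ifP => // /negbT; rewrite -ltNge.
  rewrite !TD//; [|exact: (spaceZ (V:=V))..]; rewrite !TZ// => TXu.
  have : normc ((e n)%:C * T n (u n) + (e n)%:C * T n (u n)) <=
     normc (T n (X n) + (e n)%:C * T n (u n)) +
     normc (T n (X n) + - (e n)%:C * T n (u n)).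
    apply: le_trans (normcB _ _); rewrite le_eqVlt; apply/orP; left; apply/eqP.
    by congr normc; ring.
  rewrite -mulr2n normcMn normcM normc_real (ger0_norm (ltW (e_gt0 n))).
  by have := T_ge n; have := e_gt0 n; nra.
have /choice[x Xx] : forall k, exists l,
    (X^~ k : nat -> R[i]^o) @ \oo --> (l : R[i]^o).
  move=> k; apply/cvg_ex.
  have : cvgn (series (fun n => X n.+1 k - X n k : R[i]^o)).
    apply: (@abs_summable_cvg _ _ (3 / 2)) => n.
    rewrite (@le_trans _ _ (\sum_(0 <= m < n) e m))//.
      apply: ler_sum => m _.
      have -> : X m.+1 k - X m k = next m (X m) k by rewrite /= addrAC subrr add0r.
      exact: (ball_coord V_weights k (next_ball m (X m))).
    have : \sum_(0 <= m < n) e m = 3 / 2 * (1 - e n).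
      elim: n => [|n ih]; first by rewrite big_geq// /e expr0 subrr mulr0.
      by rewrite big_nat_recr//= ih eS; field.
    by move=> ->; have := e_gt0 n; nra.
  by rewrite /series/=; under eq_fun do rewrite telescope_sumr//= subr0.
have xXB n : ball (fun k => x k - X n k) (3 / 2 * e n).
  apply: (@ball_lim _ _ (fun d k => X (n + d)%N k - X n k)) => [k|d]; last first.
    exact: XB'.
  apply: (@cvgcD _ (fun d => X (n + d)%N k) (fun=> - X n k)); last exact: cvg_cst.
  exact: (cvg_comp _ _ (cvg_addnl n) (Xx k)).
have x_space : space_of V x.
  exists (3 / 2 * e 0); have := xXB 0%N.
  by congr ball; apply/funext => k; rewrite subr0.
have [N TN] := a_ptw x x_space.
have Tx n : n%:R / 6 <= normc (T n x).
  have xE : x = fun k => X n.+1 k + (x k - X n.+1 k).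
    by apply/funext => k; rewrite addrC subrK.
  have dX : space_of V (fun k => x k - X n.+1 k) by exists (3 / 2 * e n.+1).
  have TxE : T n x = T n (X n.+1) + T n (fun k => x k - X n.+1 k).
    by rewrite [in LHS]xE TD.
  have := normcB (T n x) (T n (fun k => x k - X n.+1 k)).
  rewrite [X in normc (X - _)]TxE addrK => h.
  have : normc (T n (fun k => x k - X n.+1 k)) <= s n * (3 / 2 * e n.+1).
    by apply: T_le => //; rewrite mulr_gt0.
  rewrite eS; have := TX n; have := s_ge n; rewrite ler_pdivrMr//.
  lra.
have := TN (f (Num.truncn (6 * N)).+1).1.1.
have := Tx (Num.truncn (6 * N)).+1.
have := truncnS_gt (6 * N); rewrite /T; lra.
Qed.

(** * Matrix maps into bounded and into absolutely summable sequences *)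

Variable A : nat -> nat -> R[i].
Hypothesis A_dual : forall j, exists M, dual (A j) M.

Lemma bounded_image :
  (forall x, space_of V x -> exists N, forall j, normc (pairing (A j) x) <= N)
  <-> exists M, forall j, dual (A j) M.
Proof.
split=> [|[M AM] x]; first exact: uniform_boundedness.
case/(space_ball V_weights) => r r0 xr; exists (M * r) => j.
exact: (pairing_le V_weights (AM j)).
Qed.

End UniformBoundedness.

Section FiniteSums.
Variable R : realType.

Lemma fset_filter_sum (W : nmodType) (F : nat -> W) (P : pred nat) n :
  \sum_(j <- [fset j in iota 0 n | P j]%fset) F j =
  \sum_(0 <= j < n | P j) F j.
Proof.
rewrite -[RHS]big_filter; apply: perm_big; apply: uniq_perm => //.
- by rewrite filter_uniq// iota_uniq.
- by move=> j; rewrite !inE mem_filter /index_iota subn0 andbC.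
Qed.

Lemma fset_sum_le (F : nat -> R) (J : {fset nat}) : (forall j, 0 <= F j) ->
  exists n, \sum_(j <- J) F j <= \sum_(0 <= j < n) F j.
Proof.
move=> F0; exists (\max_(j <- J) j)%N.+1.
have -> : \sum_(j <- J) F j = \sum_(0 <= j < (\max_(j <- J) j)%N.+1 | j \in J) F j.
  rewrite -[RHS]big_filter; apply: perm_big; apply: uniq_perm => //.
    by rewrite filter_uniq// iota_uniq.
  move=> j; rewrite mem_filter /index_iota subn0 mem_iota add0n leq0n/=.
  case: (boolP (j \in J)) => //= jJ.
  by rewrite ltnS; apply/esym; exact: (leq_bigmax_seq (F := id)).
by rewrite big_mkcond/=; apply: ler_sum => j _; case: ifP.
Qed.

Lemma abs_sum_le_fset_real (F : nat -> R) (M : R) :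
  (forall J : {fset nat}, `|\sum_(j <- J) F j| <= M) ->
  forall n, \sum_(0 <= j < n) `|F j| <= 2 * M.
Proof.
move=> FM n; rewrite (bigID (fun j => 0 <= F j))/=.
rewrite (eq_bigr F); last by move=> j; exact: ger0_norm.
rewrite [X in _ + X](eq_bigr (fun j => - F j)); last first.
  by move=> j; rewrite -ltNge => /ltr0_norm.
rewrite sumrN mulr_natl mulr2n lerD//.
  have := FM [fset j in iota 0 n | 0 <= F j]%fset; rewrite fset_filter_sum.
  by apply: le_trans; exact: ler_norm.
have := FM [fset j in iota 0 n | ~~ (0 <= F j)]%fset; rewrite fset_filter_sum.
by apply: le_trans; rewrite -normrN ler_norm.
Qed.

(** Splitting the real and the imaginary parts by sign leaves four subsums, each
    of modulus at most [M]. *)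
Lemma abs_sum_le_fset (z : nat -> R[i]) (M : R) :
  (forall J : {fset nat}, normc (\sum_(j <- J) z j) <= M) ->
  forall n, \sum_(0 <= j < n) normc (z j) <= 4 * M.
Proof.
move=> zM n; apply: (@le_trans _ _ (\sum_(0 <= j < n) (`|Re (z j)| + `|Im (z j)|))).
  by apply: ler_sum => j _; exact: normc_le_ReIm.
rewrite big_split/= (_ : 4 * M = 2 * M + 2 * M); last by ring.
apply: lerD; apply: abs_sum_le_fset_real => J.
  by rewrite -Re_sum; apply: le_trans (zM J); exact: ler_Re_normc.
by rewrite -Im_sum; apply: le_trans (zM J); exact: ler_Im_normc.
Qed.

Variable V : set (nat -> R).
Hypothesis V_weights : weights V.
Variable A : nat -> nat -> R[i].
Hypothesis A_dual : forall j, exists M, dual_ball_of V (A j) M.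

(** The finite sums of rows are the functionals to which uniform boundedness
    applies: they are pointwise bounded by [sum_j |(A x) j|], and conversely they
    control that sum up to the factor [4] of [abs_sum_le_fset]. *)
Lemma summable_image :
  (forall x, space_of V x ->
    exists N, forall n, \sum_(0 <= j < n) normc (pairing (A j) x) <= N)
  <-> exists M, forall J : {fset nat},
      dual_ball_of V (fun k => \sum_(j <- J) A j k) M.
Proof.
split=> [AN|[M AM] x xX].
  apply: (uniform_boundedness V_weights) => [J|x xX]; first exact: (dual_ball_sum (V:=V)).
  have [N AxN] := AN x xX; exists N => J; rewrite (pairing_sum V_weights)//.
  apply: le_trans (normc_sum _ _ _) _.
  have [j|n /le_trans] := @fset_sum_le (fun j => normc (pairing (A j) x)) J.
    exact: normc_ge0.
  by apply.
have [r r0 xr] := space_ball V_weights xX; exists (4 * (M * r)) => n.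
apply: abs_sum_le_fset => J; rewrite -(pairing_sum V_weights)//.
exact: (pairing_le V_weights (AM J)).
Qed.

End FiniteSums.

(** * Matrix maps into convergent and null sequences: spaces with AK *)

(** The AK property. It holds in [l_1] and in [l_p], and fails in [l_oo]. *)
Definition sectional (R : realType) (V : set (nat -> R)) :=
  forall x, space_of V x -> forall e, 0 < e ->
  exists N, ball_of V (fun k => if (N <= k)%N then x k else 0) e.

Section ConvergentImages.
Variables (R : realType) (V : set (nat -> R)) (A : nat -> nat -> R[i]).
Hypothesis V_weights : weights V.
Local Notation space := (space_of V).
Local Notation dual := (dual_ball_of V).

Lemma space_delta i : space (fun k => (k == i)%:R).
Proof. by exists 1; exact: ball_delta. Qed.

Lemma columns_cvg :
  (forall x, space x -> cvgn (fun j => pairing (A j) x)) ->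
  forall k, cvgn (A^~ k : nat -> R[i]^o).
Proof.
move=> Ac k; have := Ac _ (space_delta k).
by under eq_fun do rewrite pairing_delta.
Qed.

Hypothesis A_dual : forall j, exists M, dual (A j) M.

Lemma convergent_image_bounded :
  (forall x, space x -> cvgn (fun j => pairing (A j) x)) ->
  exists M, forall j, dual (A j) M.
Proof.
by move=> Ac; apply/(bounded_image V_weights A_dual) => x /Ac /cvgn_normc_bounded.
Qed.

Hypothesis V_sectional : sectional V.

(** The head of [x] involves finitely many columns, and its tail is small in norm,
    hence negligible uniformly in the rows. *)
Lemma sectional_pairing_cvg (b : nat -> R[i]) (M : R) x :
  (forall j, dual (A j) M) ->
  (forall k, (A^~ k : nat -> R[i]^o) @ \oo --> (b k : R[i]^o)) ->
  space x -> (fun j => pairing (A j) x) @ \oo --> pairing b x.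
Proof.
move=> AM Ab xX; have bM : dual b M by exact: dual_lim Ab AM.
have M0 : 0 <= M by exact: dual_ge0 bM.
apply/cvg_normcP => e e0.
have d0 : 0 < e / (4 * (M + 1)) by rewrite divr_gt0// mulr_gt0// ltr_wpDl.
have [N xN] := V_sectional xX d0.
pose y k := if (N <= k)%N then x k else 0; pose z k := if (N <= k)%N then 0 else x k.
have [r xr] := xX.
have zX : space z.
  exists r; apply: (ball_solid V_weights _ xr) => k; rewrite /z.
  by case: ifP; rewrite ?normc0 ?normc_ge0.
have yX : space y by exists (e / (4 * (M + 1))).
have xE : x = fun k => z k + y k.
  by apply/funext => k; rewrite /z /y; case: ifP; rewrite ?add0r ?addr0.
have split_at a : dual a M -> pairing a x =
    \sum_(0 <= k < N) a k * x k + pairing a y.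
  move=> aM; rewrite [in LHS]xE (pairingD V_weights aM)//; congr (_ + _).
  rewrite (@pairing_fin _ _ _ N) => [|k Nk]; last by rewrite /z Nk mulr0.
  rewrite big_nat [RHS]big_nat; apply: eq_bigr => k /andP[_ kN].
  by rewrite /z leqNgt kN.
have tail a : dual a M -> normc (pairing a y) <= e / 4.
  move=> aM; apply: le_trans (pairing_le V_weights aM d0 xN) _.
  rewrite mulrCA ler_pM2l// ler_pdivrMr ?mulr_gt0 ?ltr_wpDl//; lra.
have /cvg_normcP : (fun j => \sum_(0 <= k < N) A j k * x k : R[i]^o) @ \oo -->
    (\sum_(0 <= k < N) b k * x k : R[i]^o).
  by apply: cvgn_sum => k; apply: cvgcM; [exact: Ab|exact: cvg_cst].
move=> /(_ (e / 4)) [|J HJ]; first by rewrite divr_gt0.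
exists J => j /HJ; rewrite (split_at b)// (split_at (A j))//.
set s := \sum_(_ <= _ < _) _; set t := \sum_(_ <= _ < _) _ => st.
have -> : s + pairing b y - (t + pairing (A j) y) =
   (s - t) + (pairing b y - pairing (A j) y) by ring.
apply: (le_lt_trans (normcD _ _)).
have := normcB (pairing b y) (pairing (A j) y).
have := tail _ bM; have := tail _ (AM j); lra.
Qed.

Lemma sectional_convergent_image :
  (forall x, space x -> cvgn (fun j => pairing (A j) x)) <->
  (forall k, cvgn (A^~ k : nat -> R[i]^o)) /\ exists M, forall j, dual (A j) M.
Proof.
split=> [Ac|[Ac [M AM]] x xX].
  by split; [exact: columns_cvg|exact: convergent_image_bounded].
by apply: cvgP (sectional_pairing_cvg AM _ xX) => k; exact: Ac.
Qed.

Lemma sectional_null_image :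
  (forall x, space x ->
    (fun j => pairing (A j) x) @ \oo --> (0 : R[i]^o)) <->
  (forall k, (A^~ k : nat -> R[i]^o) @ \oo --> (0 : R[i]^o)) /\
  exists M, forall j, dual (A j) M.
Proof.
split=> [A0|[A0 [M AM]] x xX].
  split; last by apply: convergent_image_bounded => x /A0 /cvgP.
  move=> k; have := A0 _ (space_delta k).
  by under eq_fun do rewrite pairing_delta.
have := sectional_pairing_cvg AM A0 xX.
rewrite (@pairing_fin _ (fun=> 0) _ 0%N) => [|k _]; last by rewrite mul0r.
by rewrite big_geq.
Qed.

End ConvergentImages.

(** * Matrix maps on bounded sequences: the Schur theorem *)

Definition sup_weights (R : realType) : set (nat -> R) :=
  [set v | exists i, v = fun k => (k == i)%:R].

Section SupWeights.
Variable R : realType.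
Implicit Types (a x : nat -> R[i]) (M r : R).

Lemma sup_weights_weights : weights (@sup_weights R).
Proof.
split=> [_ k [i ->]|k]; first by rewrite ler0n lern1 leq_b1.
by exists (fun i => (i == k)%:R); [exists k|rewrite eqxx].
Qed.

Lemma sup_ballP x M : 0 <= M ->
  ball_of (@sup_weights R) x M <-> forall k, normc (x k) <= M.
Proof.
move=> M0; split=> [xM k|xM _ n [i ->]]; first exact: (ball_coord sup_weights_weights k xM).
apply: (@le_trans _ _ (\sum_(0 <= k < n | k == i) M)).
  rewrite [leRHS]big_mkcond/=; apply: ler_sum => k _.
  by case: eqP => _; rewrite ?mul1r ?mul0r.
by rewrite big_nat1_eq; case: ifP.
Qed.

Lemma sup_dualP a M :
  dual_ball_of (@sup_weights R) a M <->
  forall n, \sum_(0 <= k < n) normc (a k) <= M.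
Proof.
split=> [aM n|aM x /(sup_ballP _ ler01) x1 n].
  have /aM/(_ n) : ball_of (@sup_weights R) (fun=> 1) 1.
    by apply/(sup_ballP _ ler01) => k; rewrite normc1.
  by under eq_bigr do rewrite normc1 mulr1.
apply: le_trans (aM n); apply: ler_sum => k _.
by rewrite ler_piMr ?normc_ge0.
Qed.

End SupWeights.

Section Schur.
Variables (R : realType) (A : nat -> nat -> R[i]).
Local Notation ell1_bound a M := (forall n, \sum_(0 <= k < n) normc (a k) <= M).
Hypothesis A_ell1 : forall j, exists M, ell1_bound (A j) M.

(** The columns are null, so the head of a late row is small; the row belongs to
    [l_1], so its tail is small too; the block in between carries the rest. *)
Lemma hump (e : R) : 0 < e ->
  (forall k, (A^~ k : nat -> R[i]^o) @ \oo --> (0 : R[i]^o)) ->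
  (forall J, exists j n, (J <= j)%N /\ e < \sum_(0 <= k < n) normc (A j k)) ->
  forall J N, exists j N', [/\ (J <= j)%N, (N <= N')%N,
    \sum_(0 <= k < N) normc (A j k) <= e / 8,
    3 / 4 * e <= \sum_(N <= k < N') normc (A j k) &
    forall m, \sum_(N' <= k < m) normc (A j k) <= e / 8].
Proof.
move=> e0 A0 big J N; have e80 : 0 < e / 8 by rewrite divr_gt0.
have head_cvg : (fun j => \sum_(0 <= k < N) normc (A j k)) @ \oo -->
    \sum_(0 <= k < N) normc (0 : R[i]).
  by apply: cvgn_sum => k; exact: normc_cvg.
rewrite [X in _ --> X]big1 in head_cvg; last by move=> k _; exact: normc0.
have /cvgrPdist_lt/(_ _ e80)[J' _ HJ'] := head_cvg.
have [j [n [jJ jn]]] := big (maxn J J').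
move: jJ; rewrite geq_max => /andP[Jj /HJ'] /=.
rewrite sub0r normrN ger0_norm ?sumr_ge0// => [head|k _]; last exact: normc_ge0.
have [M jM] := A_ell1 j.
have [N1 tail] := nonneg_series_tail (fun k => normc_ge0 (A j k)) jM e80.
have sum_le m m' p : (p <= m)%N -> (m <= m')%N ->
    \sum_(p <= k < m) normc (A j k) <= \sum_(p <= k < m') normc (A j k).
  move=> pm mm'; rewrite [leRHS](big_cat_nat pm mm')/= lerDl.
  by apply: sumr_ge0 => k _; exact: normc_ge0.
exists j, (maxn N (maxn n N1)); split => //.
- by rewrite leq_maxl.
- exact: ltW.
- have := @sum_le n (maxn N (maxn n N1)) 0%N (leq0n _).
  rewrite leq_max leq_maxl orbT => /(_ isT).
  by rewrite (big_cat_nat (leq0n N) (leq_maxl N _))/=; lra.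
- move=> m; have [mN|Nm] := leqP m (maxn N (maxn n N1)); first by rewrite big_geq// ltW.
  apply: le_trans (tail m).
  have N1N : (N1 <= maxn N (maxn n N1))%N by rewrite !leq_max leqnn !orbT.
  rewrite [leRHS](big_cat_nat N1N (ltnW Nm))/= lerDr.
  by apply: sumr_ge0 => k _; exact: normc_ge0.
Qed.

(** A gliding hump with alternating signs: were the row sums not null, a bounded
    sequence with the phases of the successive humps, and opposite signs on
    consecutive ones, would have an oscillating image. *)
Theorem schur :
  (forall k, (A^~ k : nat -> R[i]^o) @ \oo --> (0 : R[i]^o)) ->
  (forall x, (forall k, normc (x k) <= 1) -> cvgn (fun j => pairing (A j) x)) ->
  forall e : R, 0 < e -> exists J, forall j, (J <= j)%N -> ell1_bound (A j) e.
Proof.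
move=> A0 Ac e e0; apply: contrapT => /forallNP nbd.
have big J : exists j n, (J <= j)%N /\ e < \sum_(0 <= k < n) normc (A j k).
  have /existsNP[j /not_implyP[Jj /existsNP[n /negP]]] := nbd J.
  by rewrite -ltNge => jn; exists j, n.
have /choice[g gP] : forall s : nat * nat, exists t : nat * nat,
    [/\ (s.1 <= t.1)%N, (s.2 <= t.2)%N,
    \sum_(0 <= k < s.2) normc (A t.1 k) <= e / 8,
    3 / 4 * e <= \sum_(s.2 <= k < t.2) normc (A t.1 k) &
    forall m, \sum_(t.2 <= k < m) normc (A t.1 k) <= e / 8].
  by move=> s; have [j [N' h]] := hump e0 A0 big s.1 s.2; exists (j, N').
(* The rows and the block boundaries; [N i] to [N i.+1] is the i-th block. *)
pose s i := iter i (fun s => ((g s).1.+1, (g s).2)) (0%N, 0%N).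
pose row i := (g (s i)).1; pose N i := (s i).2.
have NS i : (g (s i)).2 = N i.+1 by [].
have N_mono i i' : (i <= i')%N -> (N i <= N i')%N.
  move=> /subnKC <-; elim: (i' - i)%N => [|d ih]; first by rewrite addn0.
  by rewrite addnS (leq_trans ih)// -NS; have [] := gP (s (i + d)%N).
have s_ge i : (i <= (s i).1)%N.
  by elim: i => // i ih; apply: leq_ltn_trans ih _; have [] := gP (s i).
have row_ge i : (i <= row i)%N.
  by apply: leq_trans (s_ge i) _; have [] := gP (s i).
pose sg i : R[i] := (-1) ^+ i.
have sg1 i : normc (sg i) = 1.
  rewrite /sg; elim: i => [|i ih]; first by rewrite expr0 normc1.
  by rewrite exprS normcM ih normcN normc1 mulr1.
have /choice[x xP] : forall k, exists z, normc z <= 1 /\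
    forall i, (N i <= k < N i.+1)%N -> z = sg i * phase (A (row i) k).
  move=> k; have [[i ik]|no] := pselect (exists i, (N i <= k < N i.+1)%N).
    exists (sg i * phase (A (row i) k)); split=> [|i' ik'].
      by rewrite normcM sg1 mul1r normc_phase.
    suff -> : i = i' by [].
    move: ik ik' => /andP[h1 h2] /andP[h3 h4].
    case: (ltngtP i i') => // /N_mono h; have := leq_trans h _.
      by move=> /(_ _ h3); rewrite leqNgt h2.
    by move=> /(_ _ h1); rewrite leqNgt h4.
  by exists 0; split=> [|i ik]; [rewrite normc0|case: no; exists i].
pose B i := \sum_(N i <= k < N i.+1) normc (A (row i) k).
have Bge i : 3 / 4 * e <= B i by have [] := gP (s i).
have hump_value i : normc (pairing (A (row i)) x - sg i * (B i)%:C) <= e / 4.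
  have [M iM] := A_ell1 (row i).
  have cv : series (fun k => A (row i) k * x k : R[i]^o) @ \oo --> pairing (A (row i)) x.
    apply: (pairing_cvg (@sup_weights_weights R) (M := M)); first exact/sup_dualP.
    by exists 1; apply/(sup_ballP _ ler01) => k; have [] := xP k.
  have cv' : (fun n => series (fun k => A (row i) k * x k : R[i]^o) n +
      - (sg i * (B i)%:C) : R[i]^o) @ \oo -->
      (pairing (A (row i)) x - sg i * (B i)%:C : R[i]^o).
    by apply: cvgcD; [exact: cv|exact: cvg_cst].
  apply: (normc_lim_le (N := N i.+1) cv') => m Nm.
  rewrite /series/= (big_cat_nat (leq0n _) Nm)/=.
  have NN : (N i <= N i.+1)%N by exact: N_mono.
  rewrite (big_cat_nat (leq0n _) NN)/=.
  rewrite [X in _ + X + _ - _](_ : _ = sg i * (B i)%:C); last first.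
    rewrite /B rmorph_sum mulr_sumr big_nat [RHS]big_nat.
    apply: eq_bigr => k kN; have [_ /(_ _ kN) ->] := xP k.
    by rewrite mulrCA; congr (_ * _); rewrite mulrC phaseM.
  rewrite addrAC addrK; apply: (le_trans (normcD _ _)).
  have row_le m1 m2 : normc (\sum_(m1 <= k < m2) A (row i) k * x k) <=
      \sum_(m1 <= k < m2) normc (A (row i) k).
    apply: (le_trans (normc_sum _ _ _)); apply: ler_sum => k _.
    by rewrite normcM ler_piMr ?normc_ge0//; have [] := xP k.
  have := row_le 0%N (N i); have := row_le (N i.+1) m.
  have [_ _ + _ /(_ m)] := gP (s i); rewrite -/(row i) -/(N i) NS; lra.
have x1 k : normc (x k) <= 1 by have [] := xP k.
have /cvg_ex[l /cvg_normcP/(_ (e / 8))[|I HI]] := Ac x x1; first by rewrite divr_gt0.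
have h1 := HI _ (row_ge I); have h2 := HI _ (leq_trans (leqnSn I) (row_ge I.+1)).
have v1 := hump_value I; have v2 := hump_value I.+1.
have b1 := Bge I; have b2 := Bge I.+1.
move: h1 h2 v1 v2; set c1 := pairing _ _; set c2 := pairing _ _ => h1 h2 v1 v2.
have : normc (sg I * (B I + B I.+1)%:C) = B I + B I.+1.
  by rewrite normcM sg1 mul1r normc_real ger0_norm//; lra.
have -> : sg I * (B I + B I.+1)%:C =
    ((l - c2) - (l - c1)) -
    ((c1 - sg I * (B I)%:C) - (c2 - sg I.+1 * (B I.+1)%:C)).
  by rewrite /sg exprS rmorphD/=; ring.
have := normcB ((l - c2) - (l - c1))
  ((c1 - sg I * (B I)%:C) - (c2 - sg I.+1 * (B I.+1)%:C)).
have := normcB (l - c2) (l - c1).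
have := normcB (c1 - sg I * (B I)%:C) (c2 - sg I.+1 * (B I.+1)%:C).
lra.
Qed.

End Schur.

Section BoundedImages.
Variables (R : realType) (A : nat -> nat -> R[i]).
Local Notation ell1_bound a M := (forall n, \sum_(0 <= k < n) normc (a k) <= M).
Hypothesis A_ell1 : forall j, exists M, ell1_bound (A j) M.

Definition ell1_cvg (b : nat -> R[i]) := forall e : R, 0 < e ->
  exists J, forall j, (J <= j)%N -> ell1_bound (fun k => A j k - b k) e.

Let A_dual j : exists M, dual_ball_of (@sup_weights R) (A j) M.
Proof. by have [M jM] := A_ell1 j; exists M; exact/sup_dualP. Qed.

Lemma pairing_rowB (b : nat -> R[i]) (M : R) x j :
  ell1_bound b M -> space_of (@sup_weights R) x ->
  pairing (fun k => A j k - b k) x = pairing (A j) x - pairing b x.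
Proof.
move=> bM xX; apply/pairing_lim.
rewrite (_ : series _ = fun n => series (fun k => A j k * x k) n -
    series (fun k => b k * x k) n); last first.
  apply/funext => n; rewrite /series/= -sumrB.
  by apply: eq_bigr => k _; rewrite mulrBl.
apply: cvgcB.
  by have [M' jM'] := A_dual j; exact: (pairing_cvg (@sup_weights_weights R) jM').
by apply: (pairing_cvg (@sup_weights_weights R) (M := M)) => //; exact/sup_dualP.
Qed.

(** A bounded sequence is a bounded functional on [l_1]. *)
Lemma ell1_cvg_pairing (b : nat -> R[i]) (M : R) x :
  ell1_bound b M -> ell1_cvg b -> space_of (@sup_weights R) x ->
  (fun j => pairing (A j) x) @ \oo --> pairing b x.
Proof.
move=> bM Ab xX; have [r r0 xr] := space_ball (@sup_weights_weights R) xX.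
apply/cvg_normcP => e e0.
have [|J HJ] := Ab (e / (2 * r)); first by rewrite divr_gt0// mulr_gt0.
exists J => j /HJ jJ; rewrite normc_dist.
rewrite -(pairing_rowB _ bM)//.
have /sup_dualP jd := jJ.
apply: le_lt_trans (pairing_le (@sup_weights_weights R) jd r0 xr) _.
by rewrite invfM mulrA mulfVK ?gt_eqF//; lra.
Qed.

(** The limits [b] of the columns form an element of [l_1] because the rows are
    bounded in [l_1] by uniform boundedness, so [schur] applies to the rows minus
    [b]. It asks only for convergent images, so the limit of [A x] need not be known
    to be [sum_k b k * x k] beforehand. *)
Lemma bounded_convergent_image :
  (forall x, space_of (@sup_weights R) x -> cvgn (fun j => pairing (A j) x)) <->
  exists b, [/\ exists M, ell1_bound b M,
    forall k, (A^~ k : nat -> R[i]^o) @ \oo --> (b k : R[i]^o) & ell1_cvg b].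
Proof.
split=> [Ac|[b [[M bM] _ Ab]] x xX]; last first.
  exact: cvgP (ell1_cvg_pairing bM Ab xX).
have /choice[b Ab] : forall k, exists l,
    (A^~ k : nat -> R[i]^o) @ \oo --> (l : R[i]^o).
  by move=> k; apply/cvg_ex; exact: (columns_cvg (@sup_weights_weights R)).
have [M AM] := convergent_image_bounded (@sup_weights_weights R) A_dual Ac.
have bM : dual_ball_of (@sup_weights R) b M by exact: dual_lim Ab AM.
exists b; split => //; first by exists M; exact/sup_dualP.
apply: schur => [j|k|x x1].
- have [M' jM'] := A_ell1 j; exists (M' + M) => n.
  apply: le_trans (lerD (jM' n) ((sup_dualP _ _).1 bM n)).
  by rewrite -big_split/=; apply: ler_sum => k _; exact: normcB.
- rewrite -(subrr (b k)); apply: cvgcB; first exact: Ab.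
  exact: cvg_cst.
- have xX : space_of (@sup_weights R) x by exists 1; exact/sup_ballP.
  under eq_fun do rewrite (pairing_rowB _ ((sup_dualP _ _).1 bM))//.
  have /cvg_ex[l xl] := Ac x xX.
  have bx : (fun=> pairing b x) @ \oo --> pairing b x by exact: cvg_cst.
  have h := cvgcB xl bx.
  exact: cvgP h.
Qed.

Lemma bounded_null_image :
  (forall x, space_of (@sup_weights R) x ->
    (fun j => pairing (A j) x) @ \oo --> (0 : R[i]^o)) <->
  ell1_cvg (fun=> 0).
Proof.
have zero_bound : ell1_bound (fun=> 0 : R[i]) 0.
  by move=> n; rewrite big1// => k _; rewrite normc0.
have zero_pairing x : pairing (fun=> 0) x = 0.
  by rewrite (@pairing_fin _ _ _ 0%N) ?big_geq// => k _; rewrite mul0r.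
split=> [A0|A0 x xX]; last first.
  by have := ell1_cvg_pairing zero_bound A0 xX; rewrite zero_pairing.
have [|b [_ Ab Abl]] := bounded_convergent_image.1; first by move=> x /A0/cvgP.
suff b0 : b = fun=> 0 by rewrite -b0.
apply/funext => k.
have A0k : (A^~ k : nat -> R[i]^o) @ \oo --> (0 : R[i]^o).
  have := A0 _ (space_delta (@sup_weights_weights R) k).
  by under eq_fun do rewrite pairing_delta.
by rewrite -[RHS](cvg_lim _ A0k)//; apply/esym; exact: (cvg_lim _ (Ab k)).
Qed.

(** Scheffe's lemma for sequences. A finite head of [b] carries all but [e] of the
    total mass [S]; the rows converge there, and their total mass is at most
    about [S], so that they have little mass left elsewhere. *)
Lemma scheffe (b : nat -> R[i]) (S : R) :
  (forall k, (A^~ k : nat -> R[i]^o) @ \oo --> (b k : R[i]^o)) ->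
  ell1_bound b S ->
  (forall e : R, 0 < e -> exists n, S - e <= \sum_(0 <= k < n) normc (b k)) ->
  (forall e : R, 0 < e ->
    exists J, forall j, (J <= j)%N -> ell1_bound (A j) (S + e)) ->
  ell1_cvg b.
Proof.
move=> Ab bS b_sum A_sum e e0; have d0 : 0 < e / 5 by rewrite divr_gt0.
have [N bN] := b_sum _ d0; have [J2 HJ2] := A_sum _ d0.
have head_cvg : (fun j => \sum_(0 <= k < N) normc (A j k - b k)) @ \oo -->
    \sum_(0 <= k < N) normc (0 : R[i]).
  apply: cvgn_sum => k; apply: normc_cvg; rewrite -(subrr (b k)).
  by apply: cvgcB; [exact: Ab|exact: cvg_cst].
rewrite [X in _ --> X]big1 in head_cvg; last by move=> k _; exact: normc0.
have /cvgrPdist_lt/(_ _ d0)[J1 _ HJ1] := head_cvg.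
exists (maxn J1 J2) => j; rewrite geq_max => /andP[/HJ1 /= + /HJ2 jS].
rewrite sub0r normrN ger0_norm ?sumr_ge0// => [head n|k _]; last exact: normc_ge0.
have ge0 (f : nat -> R[i]) p m : 0 <= \sum_(p <= k < m) normc (f k).
  by apply: sumr_ge0 => k _; exact: normc_ge0.
have [nN|/ltnW Nn] := leqP n N.
  have := ge0 (fun k => A j k - b k) n N.
  by move: head; rewrite (big_cat_nat (leq0n n) nN)/=; lra.
rewrite (big_cat_nat (leq0n N) Nn)/=.
have tri : \sum_(N <= k < n) normc (A j k - b k) <=
    \sum_(N <= k < n) normc (A j k) + \sum_(N <= k < n) normc (b k).
  by rewrite -big_split/=; apply: ler_sum => k _; exact: normcB.
have trih : \sum_(0 <= k < N) normc (b k) <=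
    \sum_(0 <= k < N) normc (A j k) + \sum_(0 <= k < N) normc (A j k - b k).
  rewrite -big_split/=; apply: ler_sum => k _.
  by rewrite -[in leLHS](subKr (A j k) (b k)) normcB.
have := jS n; have := bS n; rewrite !(big_cat_nat (leq0n N) Nn)/=; lra.
Qed.

End BoundedImages.

(** * The weights of [l_1] and of [l_p] *)

Definition one_weights (R : realType) : set (nat -> R) := [set fun=> 1].

Definition lp_weights (R : realType) (p : R) : set (nat -> R) :=
  [set v | (forall k, 0 <= v k) /\ forall n, \sum_(0 <= k < n) v k `^ p <= 1].

Section TailSums.
Variable R : realType.

Lemma sum_tail (f : R -> R) (x : nat -> R[i]) N n : f 0 = 0 ->
  \sum_(0 <= k < n) f (normc (if (N <= k)%N then x k else 0)) =
  \sum_(N <= k < n) f (normc (x k)).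
Proof.
move=> f00; have [Nn|nN] := leqP N n; last first.
  rewrite [RHS]big_geq ?(ltnW nN)// big_nat big1// => k /andP[_ kn].
  by rewrite ifF ?normc0// leqNgt (ltn_trans kn nN).
rewrite (big_cat_nat (leq0n N) Nn)/= big_nat big1 ?add0r => [|k /andP[_ kN]].
  by rewrite big_nat [RHS]big_nat; apply: eq_bigr => k /andP[-> _].
by rewrite ifF ?normc0// leqNgt kN.
Qed.

End TailSums.

Section OneWeights.
Variable R : realType.
Implicit Types (a x : nat -> R[i]) (M r : R).

Lemma one_weights_weights : weights (@one_weights R).
Proof.
split=> [_ k ->|k]; first by rewrite ler01 lexx.
by exists (fun=> 1).
Qed.

Lemma one_ballP x M : ball_of (@one_weights R) x M <->
  forall n, \sum_(0 <= k < n) normc (x k) <= M.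
Proof.
split=> [xM n|xM _ n ->]; last by under eq_bigr do rewrite mul1r.
by have := xM _ n erefl; under eq_bigr do rewrite mul1r.
Qed.

Lemma one_dualP a M :
  dual_ball_of (@one_weights R) a M <-> forall k, normc (a k) <= M.
Proof.
split=> [aM k|aM x /one_ballP x1 n].
  exact: (dual_coord one_weights_weights k aM).
have M0 : 0 <= M by apply: le_trans (aM 0%N); exact: normc_ge0.
apply: (@le_trans _ _ (\sum_(0 <= k < n) M * normc (x k))).
  by apply: ler_sum => k _; rewrite ler_wpM2r ?normc_ge0.
by rewrite -mulr_sumr ler_piMr.
Qed.

Lemma one_sectional : sectional (@one_weights R).
Proof.
move=> x [M /one_ballP xM] e e0.
have [N tail] := nonneg_series_tail (fun k => normc_ge0 (x k)) xM e0.
exists N; apply/one_ballP => n.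
by rewrite (@sum_tail _ id).
Qed.

End OneWeights.

Lemma sum_powR_div (R : realType) (r M : R) (x : nat -> R[i]) n : 0 < M ->
  \sum_(0 <= k < n) normc (x k) `^ r <= M `^ r ->
  \sum_(0 <= k < n) (normc (x k) / M) `^ r <= 1.
Proof.
move=> M0 xM.
under eq_bigr => k _ do rewrite powRM ?normc_ge0 ?invr_ge0 ?(ltW M0)//.
rewrite -mulr_suml -(powR_inv1 (ltW M0)) -powRrM mulN1r powRN.
by rewrite ler_pdivrMr ?powR_gt0// mul1r.
Qed.

Section LpWeights.
Variables (R : realType) (p p' : R).
Hypotheses (p_gt0 : 0 < p) (p'_gt0 : 0 < p') (pp' : p^-1 + p'^-1 = 1).

Lemma young_sum (a b : nat -> R) n :
  (forall k, 0 <= a k) -> (forall k, 0 <= b k) ->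
  \sum_(0 <= k < n) a k `^ p <= 1 -> \sum_(0 <= k < n) b k `^ p' <= 1 ->
  \sum_(0 <= k < n) a k * b k <= 1.
Proof.
move=> a0 b0 a1 b1.
apply: (@le_trans _ _ (\sum_(0 <= k < n) (a k `^ p / p + b k `^ p' / p'))).
  by apply: ler_sum => k _; exact: conjugate_powR.
rewrite big_split/= -!mulr_suml -pp' lerD//.
  by rewrite -[leRHS]mul1r ler_pM2r ?invr_gt0.
by rewrite -[leRHS]mul1r ler_pM2r ?invr_gt0.
Qed.

(** Equality in Hoelder's inequality: test against [a k `^ (p' - 1)],
    normalized. *)
Lemma lp_norming (a : nat -> R) (M : R) : (forall k, 0 <= a k) -> 0 <= M ->
  (forall v n, lp_weights p v -> \sum_(0 <= k < n) v k * a k <= M) ->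
  forall n, \sum_(0 <= k < n) a k `^ p' <= M `^ p'.
Proof.
move=> a0 M0 aM n; set S := \sum_(0 <= k < n) _.
have S0 : 0 <= S by apply: sumr_ge0 => k _; exact: powR_ge0.
have [->|Sneq0] := eqVneq S 0; first exact: powR_ge0.
have Sgt0 : 0 < S by rewrite lt0r Sneq0.
have pE : (p' - 1) * p = p'.
  have := pp'; move/(congr1 (fun t => t * (p * p'))).
  rewrite mulrDl mul1r mulrA mulVf ?gt_eqF// mul1r mulrCA mulVf ?gt_eqF// mulr1.
  by lra.
pose v k := if (k < n)%N then a k `^ (p' - 1) / S `^ p^-1 else 0.
have v0 k : 0 <= v k by rewrite /v; case: ifP => // _; rewrite divr_ge0 ?powR_ge0.
have vp k : v k `^ p = if (k < n)%N then a k `^ p' / S else 0.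
  rewrite /v; case: ifP => _; last by rewrite powR0 ?gt_eqF.
  rewrite powRM ?powR_ge0 ?invr_ge0 ?powR_ge0// -powRrM pE; congr (_ * _).
  by rewrite -powRN -powRrM mulNr mulVf ?gt_eqF// powR_inv1.
have vW : lp_weights p v.
  split=> // m; under eq_bigr do rewrite vp.
  apply: (@le_trans _ _ (\sum_(0 <= k < n) a k `^ p' / S)).
    rewrite -big_mkcond/=; have [mn|nm] := leqP m n.
      rewrite (big_cat_nat (leq0n m) mn)/= big_nat_cond.
      rewrite (eq_bigl (fun k => (0 <= k < m)%N)) => [|k]; last first.
        by rewrite /=; case: (ltnP k m) => //= km; rewrite (leq_trans km mn).
      rewrite -big_nat lerDl sumr_ge0// => k _.
      by rewrite divr_ge0 ?powR_ge0.
    rewrite (big_cat_nat (leq0n n) (ltnW nm))/= [X in _ + X]big_nat_cond.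
    rewrite [X in _ + X]big1 ?addr0 => [|k]; last first.
      by rewrite -andbA => /and3P[nk _]; rewrite ltnNge nk.
    rewrite big_mkcond; apply: ler_sum => k _; case: ifP => // _.
    by rewrite divr_ge0 ?powR_ge0.
  by rewrite -mulr_suml divff.
have := aM v n vW.
have -> : \sum_(0 <= k < n) v k * a k = S `^ p'^-1.
  have -> : p'^-1 = 1 - p^-1 by rewrite -pp' addrAC subrr add0r.
  rewrite powRB ?Sneq0 ?implybT// powRr1// /S mulr_suml.
  rewrite big_nat [RHS]big_nat; apply: eq_bigr => k /andP[_ kn].
  by rewrite /v kn mulrAC [_ * a k]mulrC mulr_powRB1.
move=> SM; rewrite -[leLHS]powRr1// -(mulVf (lt0r_neq0 p'_gt0)) powRrM.
by apply: ge0_ler_powR; rewrite ?nnegrE ?powR_ge0// ltW.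
Qed.

End LpWeights.

Section LpSpaces.
Variables (R : realType) (p p' : R).
Hypotheses (p_gt0 : 0 < p) (p'_gt0 : 0 < p') (pp' : p^-1 + p'^-1 = 1).
Implicit Types (a x : nat -> R[i]) (M r : R).

Let p'p : p'^-1 + p^-1 = 1. Proof. by rewrite addrC. Qed.

Lemma lp_weights_weights : weights (lp_weights p').
Proof.
split=> [v k [v0 v1]|i].
  rewrite v0/= leNgt; apply/negP => vk; have := v1 k.+1.
  rewrite big_nat_recr//= leNgt => /negP; apply.
  apply: (@lt_le_trans _ _ (v k `^ p')).
    have : 1 `^ p' < v k `^ p' by rewrite gt0_ltr_powR// nnegrE.
    by rewrite powR1.
  by rewrite lerDr sumr_ge0// => j _; exact: powR_ge0.
exists (fun k => (k == i)%:R) => [|]; last by rewrite eqxx.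
split=> [k|n]; first exact: ler0n.
apply: (@le_trans _ _ (\sum_(0 <= k < n | k == i) 1)).
  rewrite [leRHS]big_mkcond/=; apply: ler_sum => k _.
  by case: eqP => _; rewrite ?powR1// powR0 ?gt_eqF.
by rewrite big_nat1_eq; case: ifP.
Qed.

Lemma lp_ballP x M : 0 < M -> ball_of (lp_weights p') x M <->
  forall n, \sum_(0 <= k < n) normc (x k) `^ p <= M `^ p.
Proof.
move=> M0; split=> [xM|xM v n [v0 v1]].
  by apply: (lp_norming p'_gt0 p_gt0 p'p _ (ltW M0)) => // k; exact: normc_ge0.
have : \sum_(0 <= k < n) v k * (normc (x k) / M) <= 1.
  apply: (young_sum p'_gt0 p_gt0 p'p) => // [k|].
    by rewrite divr_ge0 ?normc_ge0 ?ltW.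
  exact: sum_powR_div.
under eq_bigr do rewrite mulrA.
by rewrite -mulr_suml ler_pdivrMr// mul1r.
Qed.

(** The nonnegative part of the unit ball of [l_p] is [lp_weights p], so this is
    [lp_ballP] with the exponents exchanged. *)
Lemma lp_dualP a M : 0 < M -> dual_ball_of (lp_weights p') a M <->
  forall n, \sum_(0 <= k < n) normc (a k) `^ p' <= M `^ p'.
Proof.
move=> M0; split=> [aM|aM x /(lp_ballP _ ltr01) x1 n].
  apply: (lp_norming p_gt0 p'_gt0 pp' _ (ltW M0)) => [k|v n [v0 v1]].
    exact: normc_ge0.
  have /aM/(_ n) : ball_of (lp_weights p') (fun k => (v k)%:C) 1.
    apply/(lp_ballP _ ltr01) => m; rewrite powR1.
    by under eq_bigr do rewrite normc_real ger0_norm//.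
  by under eq_bigr do rewrite normc_real ger0_norm// mulrC.
have : \sum_(0 <= k < n) normc (x k) * (normc (a k) / M) <= 1.
  apply: (young_sum p_gt0 p'_gt0 pp') => [k|k||]; first exact: normc_ge0.
  - by rewrite divr_ge0 ?normc_ge0 ?ltW.
  - by have := x1 n; rewrite powR1.
  - exact: sum_powR_div.
under eq_bigr do rewrite mulrA [_ * normc (a _)]mulrC.
by rewrite -mulr_suml ler_pdivrMr// mul1r.
Qed.

Lemma lp_spaceP x : space_of (lp_weights p') x <->
  exists M, forall n, \sum_(0 <= k < n) normc (x k) `^ p <= M.
Proof.
split=> [/(space_ball lp_weights_weights)[M M0 /(lp_ballP _ M0) xM]|[M xM]].
  by exists (M `^ p).
have M1 : 0 < `|M| + 1 by rewrite ltr_wpDl.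
exists ((`|M| + 1) `^ p^-1); apply/lp_ballP; first exact: powR_gt0.
move=> n; rewrite -powRrM mulVf ?gt_eqF// powRr1 ?(ltW M1)//.
by apply: le_trans (xM n) _; have := ler_norm M; lra.
Qed.

Lemma lp_uniform_dualP (I : Type) (a : I -> nat -> R[i]) :
  (exists M, forall i, dual_ball_of (lp_weights p') (a i) M) <->
  exists M, forall i n, \sum_(0 <= k < n) normc (a i k) `^ p' <= M.
Proof.
split=> [[M aM]|[M aM]].
  have M1 : 0 < `|M| + 1 by rewrite ltr_wpDl.
  exists ((`|M| + 1) `^ p') => i; apply/(lp_dualP _ M1).
  by apply: dual_le (aM i); have := ler_norm M; lra.
have M1 : 0 < `|M| + 1 by rewrite ltr_wpDl.
exists ((`|M| + 1) `^ p'^-1) => i; apply/lp_dualP; first exact: powR_gt0.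
move=> n; rewrite -powRrM mulVf ?gt_eqF// powRr1 ?(ltW M1)//.
by apply: le_trans (aM i n) _; have := ler_norm M; lra.
Qed.

Lemma lp_sectional : sectional (lp_weights p').
Proof.
move=> x /lp_spaceP[M xM] e e0.
have [N tail] := nonneg_series_tail (fun k => @powR_ge0 R (normc (x k)) p) xM
  (@powR_gt0 R e p e0).
exists N; apply/(lp_ballP _ e0) => n; rewrite (@sum_tail _ (fun z => z `^ p)) => [|].
- exact: tail.
- by rewrite powR0 ?gt_eqF.
Qed.

End LpSpaces.

(** * Inverting the q-difference operator *)

Section Convolution.

Lemma triangle_exchange (W : nmodType) (F : nat -> nat -> W) n :
  \sum_(0 <= k < n) \sum_(0 <= v < k.+1) F k v =
  \sum_(0 <= v < n) \sum_(v <= k < n) F k v.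
Proof.
elim: n => [|n ih]; first by rewrite !big_geq.
rewrite big_nat_recr//= ih [X in _ + X]big_nat_recr//= [RHS]big_nat_recr//=.
rewrite big_nat1 addrA; congr (_ + _); rewrite -big_split/=.
rewrite big_nat [RHS]big_nat; apply: eq_bigr => v /andP[_ vn].
by rewrite big_nat_recr// ltnW.
Qed.

Variable K : comNzRingType.
Implicit Types u v w : nat -> K.

Definition cauchy_prod u v n := \sum_(0 <= k < n.+1) u (n - k)%N * v k.

Lemma cauchy_prodA u v w : cauchy_prod u (cauchy_prod v w) =1 cauchy_prod (cauchy_prod u v) w.
Proof.
move=> n; rewrite /cauchy_prod; under eq_bigr do rewrite mulr_sumr.
rewrite triangle_exchange big_nat [RHS]big_nat; apply: eq_bigr => l /andP[_ ln].
rewrite mulr_suml -{1}[l]add0n big_addn subSn//.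
rewrite big_nat [RHS]big_nat; apply: eq_bigr => k _.
by rewrite addnK mulrA subnDA [in RHS]subnAC.
Qed.

Lemma cauchy_prodC u v : cauchy_prod u v =1 cauchy_prod v u.
Proof.
move=> n; rewrite /cauchy_prod big_nat_rev/= add0n big_nat [RHS]big_nat.
by apply: eq_bigr => k /andP[_ kn]; rewrite subSS subKn// mulrC.
Qed.

Lemma cauchy_prod_delta u w : (forall n, u n = (n == 0%N)%:R) -> cauchy_prod u w =1 w.
Proof.
move=> u0 n; rewrite /cauchy_prod big_nat_recr//= subnn u0 mul1r.
rewrite big_nat big1 ?add0r// => k /andP[_ kn].
by rewrite u0 subn_eq0 leqNgt kn mul0r.
Qed.

(** The generating functions [A] and [B] of the two sequences satisfy
    [(1 - c x) A(x) = (1 - x) A(q x)] and [(1 - x) B(x) = (1 - c x) B(q x)];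
    their product is thus invariant under [x -> q x], hence constant. *)
Lemma cauchy_prod_qinverse (q c : K) (a b : nat -> K) :
  (forall n, GRing.lreg (1 - q ^+ n.+1)) ->
  a 0%N * b 0%N = 1 ->
  (forall n, a n.+1 * (1 - q ^+ n.+1) = (c - q ^+ n) * a n) ->
  (forall n, b n.+1 * (1 - q ^+ n.+1) = (1 - c * q ^+ n) * b n) ->
  forall n, cauchy_prod a b n = (n == 0%N)%:R.
Proof.
move=> q_reg ab0 aS bS.
have rec n : (1 - q ^+ n.+1) * cauchy_prod a b n.+1 = c * (1 - q ^+ n) * cauchy_prod a b n.
  have split k : (k < n.+2)%N -> (1 - q ^+ n.+1) * (a (n.+1 - k)%N * b k) =
      a (n.+1 - k)%N * (1 - q ^+ (n.+1 - k)) * b k +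
      q ^+ (n.+1 - k) * a (n.+1 - k)%N * (b k * (1 - q ^+ k)).
    move=> kn; have -> : q ^+ n.+1 = q ^+ (n.+1 - k) * q ^+ k.
      by rewrite -exprD subnK.
    by ring.
  rewrite /cauchy_prod !mulr_sumr big_nat.
  under eq_bigr => k /andP[_ kn] do rewrite split//.
  rewrite -big_nat big_split/= big_nat_recr//= subnn expr0 subrr mulr0 mul0r addr0.
  rewrite [X in _ + X]big_nat_recl//= expr0 subrr !mulr0 add0r.
  rewrite -big_split/= big_nat [RHS]big_nat.
  apply: eq_bigr => k /andP[_ kn]; rewrite subSn// aS subSS bS.
  have -> : q ^+ n = q ^+ (n - k) * q ^+ k by rewrite -exprD subnK.
  by ring.
elim=> [|n ih]; first by rewrite /cauchy_prod big_nat1.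
apply: (q_reg n); rewrite rec ih mulr0.
by case: n {rec ih} => [|n]; rewrite ?expr0 ?subrr ?mulr0 ?mul0r.
Qed.

End Convolution.

Section Nabla.
Variables (R : realType) (q gamma : R).
Hypotheses (q_gt0 : 0 < q) (q_lt1 : q < 1).

(** The coefficient of [x ^ n] in [(x; q)_oo / (q^gamma x; q)_oo]. *)
Definition nabla_coef (n : nat) : R := (-1) ^+ n * q ^+ 'C(n, 2)
  * ((\prod_(0 <= i < n) qnum q (gamma - i%:R)) / qfact q n).

Let q_neq0 : q != 0. Proof. exact: lt0r_neq0. Qed.

Let q1_neq0 : 1 - q != 0. Proof. by rewrite subr_eq0 gt_eqF. Qed.

Let qX_neq0 n : 1 - q ^+ n.+1 != 0.
Proof. by rewrite subr_eq0 gt_eqF// exprn_ilt1// ltW. Qed.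

Let qfactS n : qfact q n.+1 = qfact q n * ((1 - q ^+ n.+1) / (1 - q)).
Proof.
by rewrite /qfact big_nat_recr//= {2}/qnum (powR_mulrn n.+1 (ltW q_gt0)).
Qed.

Let qfact_neq0 n : qfact q n != 0.
Proof.
elim: n => [|n ih]; first by rewrite /qfact big_geq// oner_neq0.
by rewrite qfactS !mulf_neq0 ?invr_neq0.
Qed.

Lemma nabla_coefS n : nabla_coef n.+1 * (1 - q ^+ n.+1) = (q `^ gamma - q ^+ n) * nabla_coef n.
Proof.
rewrite /nabla_coef big_nat_recr//= qfactS binS bin1 exprD [(-1) ^+ n.+1]exprS.
have -> : qnum q (gamma - n%:R) = (1 - q `^ gamma / q ^+ n) / (1 - q).
  by rewrite /qnum powRB ?q_neq0 ?implybT// powR_mulrn ?ltW.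
have qn : q ^+ n != 0 by rewrite expf_neq0.
by field; rewrite qfact_neq0 q1_neq0 qX_neq0.
Qed.

Lemma bcoefS n : bcoef q gamma n.+1 * (1 - q ^+ n.+1) =
  (1 - q `^ gamma * q ^+ n) * bcoef q gamma n.
Proof.
rewrite /bcoef big_nat_recr//= qfactS.
have -> : qnum q (gamma + n%:R) = (1 - q `^ gamma * q ^+ n) / (1 - q).
  by rewrite /qnum powRD ?q_neq0 ?implybT// powR_mulrn ?ltW.
by field; rewrite qfact_neq0 q1_neq0 qX_neq0.
Qed.

Lemma nabla_coef_bcoef n : cauchy_prod nabla_coef (bcoef q gamma) n = (n == 0%N)%:R.
Proof.
apply: (@cauchy_prod_qinverse _ q (q `^ gamma)) => [m||m|m].
- by apply/lregP.
- rewrite /nabla_coef /bcoef /qfact !big_geq// expr0 bin0n expr0.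
  by rewrite invr1 !mulr1.
- exact: nabla_coefS.
- exact: bcoefS.
Qed.

Local Notation aC := (fun n => (nabla_coef n)%:C).
Local Notation bC := (fun n => (bcoef q gamma n)%:C).

Let nabla_coef_bcoefC n : cauchy_prod aC bC n = (n == 0%N)%:R.
Proof.
have -> : cauchy_prod aC bC n = (cauchy_prod nabla_coef (bcoef q gamma) n)%:C.
  rewrite /cauchy_prod rmorph_sum; apply: eq_bigr => k _.
  by apply/esym; exact: (rmorphM (real_complex R)).
by rewrite nabla_coef_bcoef; case: eqP.
Qed.

Lemma nabla_cauchy_prod g : nabla q gamma g =1 cauchy_prod aC g.
Proof. by []. Qed.

Definition nabla_inv (h : nat -> R[i]) : nat -> R[i] := cauchy_prod bC h.

Lemma nablaK g : nabla_inv (nabla q gamma g) = g.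
Proof.
apply/funext => n; rewrite /nabla_inv (_ : nabla _ _ g = cauchy_prod aC g)//.
rewrite cauchy_prodA cauchy_prod_delta// => m; by rewrite cauchy_prodC nabla_coef_bcoefC.
Qed.

Lemma nabla_invK h : nabla q gamma (nabla_inv h) = h.
Proof. by apply/funext => n; rewrite nabla_cauchy_prod cauchy_prodA cauchy_prod_delta. Qed.

Variable Phi : nat -> nat -> R[i].
Local Notation P := (psi_part q gamma Phi).

Lemma pairing_psi_part j m h :
  pairing (P j m) h = series (mx_row_terms Phi (nabla_inv h) j) m.+1.
Proof.
rewrite (@pairing_fin _ _ _ m.+1) => [|k mk]; last first.
  by rewrite /psi_part leqNgt mk mul0r.
rewrite /series/= /mx_row_terms /nabla_inv /cauchy_prod.
under [RHS]eq_bigr do rewrite mulr_sumr.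
rewrite triangle_exchange big_nat [RHS]big_nat; apply: eq_bigr => k /andP[_ km].
rewrite /psi_part -ltnS km mulr_suml; apply: eq_bigr => v _; ring.
Qed.

(** The matrix of partial row sums of [Phi], read in the coordinates
    [h = nabla g], has the entries [psi_part]. *)
Lemma mx_class_nablaP (X Y : set (nat -> R[i])) :
  mx_class (nabla_domain q gamma X) Y Phi <->
  (forall j h, X h -> cvgn (fun m => pairing (P j m) h)) /\
  (forall h, X h -> Y (fun j => limn (fun m => pairing (P j m) h))).
Proof.
have cvgE j h (l : R[i]^o) : ((fun m => pairing (P j m) h) @ \oo --> l) =
    (series (mx_row_terms Phi (nabla_inv h) j) @ \oo --> l).
  by rewrite -[RHS]cvg_shiftS; under [in LHS]eq_fun do rewrite pairing_psi_part.
have limE j h : limn (fun m => pairing (P j m) h) =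
    limn (series (mx_row_terms Phi (nabla_inv h) j)).
  by rewrite /lim; congr get; apply/funext => l; exact: cvgE.
have is_cvgE j h : cvgn (fun m => pairing (P j m) h) <->
    cvgn (series (mx_row_terms Phi (nabla_inv h) j)).
  by split=> /cvg_ex[l hl]; apply/cvg_ex; exists l; move: hl; rewrite cvgE.
split=> [PhiXY|[Pc PY] g Xg].
  have XD h : X h -> nabla_domain q gamma X (nabla_inv h).
    by rewrite /nabla_domain/= nabla_invK.
  split=> [j h /XD/PhiXY[Pc _]|h /XD/PhiXY[_ Yl]]; first exact/is_cvgE.
  by under eq_fun do rewrite limE.
have := PY _ Xg; under eq_fun do rewrite limE nablaK; split => // j.
by have /is_cvgE := Pc j _ Xg; rewrite nablaK.
Qed.

(** The hypothesis on the limits is left open because they are obtained from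
    density of truncations on [l_1] and [l_p] but from [schur] on [l_oo]. *)
Lemma mx_class_psiP (V : set (nat -> R)) (X Y : set (nat -> R[i])) :
  X = space_of V ->
  (forall j, (forall h, space_of V h -> cvgn (fun m => pairing (P j m) h)) ->
    forall h, space_of V h ->
    (fun m => pairing (P j m) h) @ \oo --> pairing (psi q gamma Phi j) h) ->
  mx_class (nabla_domain q gamma X) Y Phi <->
  (forall j h, space_of V h -> cvgn (fun m => pairing (P j m) h)) /\
  (forall h, space_of V h -> Y (fun j => pairing (psi q gamma Phi j) h)).
Proof.
move=> -> Plim; rewrite mx_class_nablaP.
have limE h : (forall j h', space_of V h' -> cvgn (fun m => pairing (P j m) h')) ->
    space_of V h -> (fun j => limn (fun m => pairing (P j m) h)) =
    (fun j => pairing (psi q gamma Phi j) h).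
  move=> Pc hX; apply/funext => j.
  by have := Plim j (Pc j) h hX => /cvg_lim; apply.
by split=> -[Pc PY]; split=> // h hX; have := PY h hX; rewrite limE.
Qed.

End Nabla.

(** * Extended real suprema and series of moduli *)

Section ExtendedReals.
Variable R : realType.

Lemma ereal_sup_ltyP (I : Type) (f : I -> \bar R) :
  (ereal_sup (range f) < +oo)%E <-> exists M : R, forall i, (f i <= M%:E)%E.
Proof.
split=> [fy|[M fM]]; last first.
  apply: (@le_lt_trans _ _ M%:E); last exact: ltry.
  by apply: ge_ereal_sup => _ [i _ <-].
have fs i : (f i <= ereal_sup (range f))%E by apply: ereal_sup_ubound; exists i.
move: fy fs; case: (ereal_sup _) => [r|//|] _ fs; first by exists r.
by exists 0 => i; exact: (le_trans (fs i) (leNye _)).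
Qed.

Lemma ereal_sup_EFin_ltyP (I : Type) (f : I -> R) :
  (ereal_sup (range (fun i => (f i)%:E)) < +oo)%E <->
  exists M : R, forall i, f i <= M.
Proof.
rewrite ereal_sup_ltyP; split=> -[M fM]; exists M => i.
  by rewrite -lee_fin.
by rewrite lee_fin.
Qed.

Lemma nneseries_leP (u : nat -> R) (M : R) : (forall k, 0 <= u k) ->
  (\sum_(0 <= k <oo) (u k)%:E <= M%:E)%E <->
  forall n, \sum_(0 <= k < n) u k <= M.
Proof.
move=> u0; split=> [uM n|uM].
  rewrite -lee_fin -sumEFin; apply: le_trans uM.
  by apply: nneseries_lim_ge => k _ _; rewrite lee_fin.
apply: lime_le.
  by apply: is_cvg_nneseries => k _ _; rewrite lee_fin.
by apply: nearW => n; rewrite sumEFin lee_fin; exact: uM.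
Qed.

Lemma ereal_sup_nneseries_ltyP (I : Type) (u : I -> nat -> R) :
  (forall i k, 0 <= u i k) ->
  (ereal_sup (range (fun i => \sum_(0 <= k <oo) (u i k)%:E)) < +oo)%E <->
  exists M : R, forall i n, \sum_(0 <= k < n) u i k <= M.
Proof.
move=> u0; rewrite ereal_sup_ltyP; split=> -[M uM]; exists M => i.
  by apply/nneseries_leP.
by apply/nneseries_leP.
Qed.

Lemma nneseries_ltyP (u : nat -> R) : (forall k, 0 <= u k) ->
  (\sum_(0 <= k <oo) (u k)%:E < +oo)%E <->
  exists M : R, forall n, \sum_(0 <= k < n) u k <= M.
Proof.
move=> u0; split=> [|[M uM]]; last first.
  by apply: (@le_lt_trans _ _ M%:E); [exact/nneseries_leP|exact: ltry].
have : (0 <= \sum_(0 <= k <oo) (u k)%:E)%E.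
  by apply: nneseries_ge0 => k _ _; rewrite lee_fin.
case E : (\sum_(0 <= k <oo) (u k)%:E)%E => [r| |]// _ _.
by exists r; apply/nneseries_leP => //; rewrite E.
Qed.

Lemma nneseries_fin (u : nat -> R) n : (forall k, 0 <= u k) ->
  (forall k, (n <= k)%N -> u k = 0) ->
  (\sum_(0 <= k <oo) (u k)%:E)%E = (\sum_(0 <= k < n) u k)%:E.
Proof.
move=> u0 un; apply/eqP; rewrite eq_le; apply/andP; split; last first.
  by rewrite -sumEFin; apply: nneseries_lim_ge => k _ _; rewrite lee_fin.
apply/nneseries_leP => // m; have [nm|/ltnW mn] := leqP n m.
  rewrite (big_cat_nat (leq0n n) nm)/= [X in _ + X]big_nat_cond.
  by rewrite [X in _ + X]big1 ?addr0// => k /andP[/andP[nk _] _]; exact: un.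
by rewrite [leRHS](big_cat_nat (leq0n m) mn)/= lerDl sumr_ge0.
Qed.

End ExtendedReals.

Section TotalMass.
Variable R : realType.
Implicit Types (a b x : nat -> R[i]) (M : R).
Local Notation ell1_bound a M := (forall n, \sum_(0 <= k < n) normc (a k) <= M).

Definition total a : \bar R := (\sum_(0 <= k <oo) (normc (a k))%:E)%E.

Lemma totalP a M : ell1_bound a M -> exists S, [/\ total a = S%:E, 0 <= S,
  ell1_bound a S &
  forall e, 0 < e -> exists n, S - e <= \sum_(0 <= k < n) normc (a k)].
Proof.
move=> aM; have n0 k := normc_ge0 (a k).
have : (total a < +oo)%E by apply/nneseries_ltyP => //; exists M.
have : (0 <= total a)%E by apply: nneseries_ge0 => k _ _; rewrite lee_fin.
case E : (total a) => [S| |]// S0 _; exists S; split => //.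
  by apply/nneseries_leP => //; rewrite -/(total a) E.
move=> e e0; apply: contrapT => /forallNP h.
have : (total a <= (S - e)%:E)%E.
  by apply/nneseries_leP => // n; rewrite ltW// ltNge; exact/negP.
by rewrite E lee_fin; lra.
Qed.

Lemma total_le a S M : total a = S%:E -> ell1_bound a M -> S <= M.
Proof.
move=> aS aM; rewrite -lee_fin -aS; apply/nneseries_leP => // k.
exact: normc_ge0.
Qed.

Variable A : nat -> nat -> R[i].
Hypothesis A_ell1 : forall j, exists M, ell1_bound (A j) M.

Let row_totals :
  exists T, forall j, total (A j) = (T j)%:E /\ ell1_bound (A j) (T j).
Proof.
have /choice[T AT] : forall j, exists T,
    total (A j) = T%:E /\ ell1_bound (A j) T.
  by move=> j; have [M jM] := A_ell1 j; have [T [? _ ? _]] := totalP jM; exists T.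
by exists T.
Qed.

Lemma ell1_cvg_total b M : ell1_bound b M -> ell1_cvg A b ->
  (fun j => total (A j)) @ \oo --> total b.
Proof.
move=> bM Ab; have [S [bST _ bS _]] := totalP bM; rewrite bST.
have [T AT] := row_totals.
under eq_fun do rewrite (AT _).1.
apply: cvg_EFin; first exact: nearW.
apply/cvgrPdist_le => e e0; have [J HJ] := Ab e e0; exists J => // j /HJ jJ /=.
have [jT jB] := AT j.
rewrite ler_norml; apply/andP; split.
  suff : T j <= S + e by lra.
  apply: (total_le jT) => n; apply: le_trans (lerD (bS n) (jJ n)).
  rewrite -big_split/=; apply: ler_sum => k _; rewrite -{1}(subrK (b k) (A j k)).
  by rewrite addrC normcD.
suff : S <= T j + e by lra.
apply: (total_le bST) => n; apply: le_trans (lerD (jB n) (jJ n)).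
rewrite -big_split/=; apply: ler_sum => k _.
by rewrite -{1}(subKr (A j k) (b k)) normcB.
Qed.

Lemma total_cvg_ell1 b M :
  (forall k, (A^~ k : nat -> R[i]^o) @ \oo --> (b k : R[i]^o)) ->
  ell1_bound b M -> (fun j => total (A j)) @ \oo --> total b -> ell1_cvg A b.
Proof.
move=> Ab bM; have [S [-> S0 bS bSsup]] := totalP bM.
have [T AT] := row_totals.
under eq_fun do rewrite (AT _).1.
move=> /fine_cvgP[_ /cvgrPdist_le TS]; apply: (scheffe Ab bS bSsup) => e e0.
have [J _ HJ] := TS e e0; exists J => j /HJ /=; rewrite ler_norml => /andP[h _] n.
by apply: le_trans ((AT j).2 n) _; lra.
Qed.

Lemma total_cvg0 : (fun j => total (A j)) @ \oo --> 0%E <-> ell1_cvg A (fun=> 0).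
Proof.
have total0 : total (fun=> 0) = 0%E.
  rewrite /total (nneseries_fin (n := 0)) ?big_geq// => k; first exact: normc_ge0.
  by rewrite normc0.
have b0 : ell1_bound (fun=> 0 : R[i]) 0.
  by move=> n; rewrite big1// => k _; rewrite normc0.
split=> [|A0]; last by rewrite -total0; exact: ell1_cvg_total b0 A0.
have [T AT] := row_totals.
under eq_fun do rewrite (AT _).1.
move=> /fine_cvgP[_ /cvgrPdist_le T0] e e0.
have [J _ HJ] := T0 e e0; exists J => j /HJ /=; rewrite sub0r normrN => h n.
under eq_bigr do rewrite subr0.
by apply: le_trans ((AT j).2 n) _; apply: le_trans h; exact: ler_norm.
Qed.

End TotalMass.

Section SpacesAsBalls.
Variable R : realType.

Lemma ell1P (z : nat -> R[i]) :
  ell 1 z <-> exists M, forall n, \sum_(0 <= j < n) normc (z j) <= M.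
Proof.
rewrite /ell/=; under eq_eseriesr do rewrite powRr1 ?normc_ge0//.
by apply: nneseries_ltyP => k; exact: normc_ge0.
Qed.

Lemma ell1_space : ell 1 = space_of (@one_weights R).
Proof.
apply/funext => z; apply/propext; rewrite ell1P; split=> -[M zM]; exists M.
  exact/one_ballP.
by apply/one_ballP.
Qed.

Lemma ell_inftyP (z : nat -> R[i]) :
  ell_infty z <-> exists M, forall k, normc (z k) <= M.
Proof. exact: ereal_sup_EFin_ltyP. Qed.

Lemma ell_infty_space : @ell_infty R = space_of (@sup_weights R).
Proof.
apply/funext => z; apply/propext; rewrite ell_inftyP; split=> -[M zM]; exists M.
  by apply/sup_ballP => //; apply: le_trans (zM 0%N); exact: normc_ge0.
by move=> k; exact: (ball_coord (@sup_weights_weights R) k zM).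
Qed.

Lemma ell_space (p p' : R) : 0 < p -> 0 < p' -> p^-1 + p'^-1 = 1 ->
  ell p = space_of (lp_weights p').
Proof.
move=> p0 p'0 pp'; apply/funext => z; apply/propext.
rewrite (lp_spaceP p0 p'0 pp') /ell/=.
by apply: nneseries_ltyP => k; exact: powR_ge0.
Qed.

End SpacesAsBalls.

(** * Matrix classes on the domains of the q-difference operator *)

Section MatrixClasses.
Variables (R : realType) (q gamma : R) (Phi : nat -> nat -> R[i]).
Hypotheses (q_gt0 : 0 < q) (q_lt1 : q < 1).
Local Notation P := (psi_part q gamma Phi).
Local Notation Psi := (psi q gamma Phi).
Local Notation class X Y := (mx_class (nabla_domain q gamma X) Y Phi).

Lemma psi_part0 j m k : (m < k)%N -> P j m k = 0.
Proof. by move=> mk; rewrite /psi_part leqNgt mk. Qed.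

Lemma psi_cvg j k : cvgn (fun m => P j m k) ->
  (fun m => P j m k) @ \oo --> Psi j k.
Proof. by []. Qed.

Section Sectional.
Variables (V : set (nat -> R)) (X : set (nat -> R[i])).
Hypotheses (V_weights : weights V) (V_sectional : sectional V).
Hypothesis XV : X = space_of V.
Local Notation dual := (dual_ball_of V).

(** The common form of the conditions [cond1] and [cond2]. *)
Definition bounded_rows := forall j,
  (forall k, cvgn (fun m => P j m k)) /\ exists M, forall m, dual (P j m) M.

Let P_dual j m : exists M, dual (P j m) M.
Proof.
exists (\sum_(0 <= k < m.+1) normc (P j m k)).
by apply: dual_fin => // k; exact: psi_part0.
Qed.

Let bounded_rowsP :
  (forall j h, space_of V h -> cvgn (fun m => pairing (P j m) h)) <->
  bounded_rows.
Proof.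
split=> h j; last exact: (sectional_convergent_image V_weights (P_dual j) V_sectional).2.
by apply/(sectional_convergent_image V_weights (P_dual j) V_sectional); exact: h.
Qed.

Let psi_dual : bounded_rows -> forall j, exists M, dual (Psi j) M.
Proof.
move=> rows j; have [Pc [M PM]] := rows j.
by exists M; apply: dual_lim PM => k; exact: psi_cvg.
Qed.

Let sectional_class Y : class X Y <-> bounded_rows /\
  forall h, space_of V h -> Y (fun j => pairing (Psi j) h).
Proof.
have Plim j : (forall h, space_of V h -> cvgn (fun m => pairing (P j m) h)) ->
    forall h, space_of V h ->
    (fun m => pairing (P j m) h) @ \oo --> pairing (Psi j) h.
  move=> Pc h hX; have [Pk [M PM]] :=
    (sectional_convergent_image V_weights (P_dual j) V_sectional).1 Pc.
  by apply: (sectional_pairing_cvg V_weights V_sectional PM) => // k; exact: psi_cvg.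
apply: (iff_trans (mx_class_psiP q_gt0 q_lt1 Y XV Plim)).
by split=> -[rows h]; split=> //; apply/bounded_rowsP.
Qed.

Lemma sectional_class_ell1 : class X (ell 1) <-> bounded_rows /\
  exists M, forall J : {fset nat}, dual (fun k => \sum_(j <- J) Psi j k) M.
Proof.
rewrite sectional_class; split=> -[rows h]; split=> //.
  by apply/(summable_image V_weights (psi_dual rows)) => x /h/ell1P.
move=> x xX; apply/ell1P.
exact: ((summable_image V_weights (psi_dual rows)).2 h).
Qed.

Lemma sectional_class_ell_infty : class X (@ell_infty R) <-> bounded_rows /\
  exists M, forall j, dual (Psi j) M.
Proof.
rewrite sectional_class; split=> -[rows h]; split=> //.
  by apply/(bounded_image V_weights (psi_dual rows)) => x /h/ell_inftyP.
move=> x xX; apply/ell_inftyP.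
exact: ((bounded_image V_weights (psi_dual rows)).2 h).
Qed.

Lemma sectional_class_conv : class X (@conv_seq R) <-> bounded_rows /\
  (cond6 q gamma Phi /\ exists M, forall j, dual (Psi j) M).
Proof.
rewrite sectional_class; split=> -[rows h]; split=> //.
  exact/(sectional_convergent_image V_weights (psi_dual rows) V_sectional).
exact: (sectional_convergent_image V_weights (psi_dual rows) V_sectional).2.
Qed.

Lemma sectional_class_null : class X (@null_seq R) <-> bounded_rows /\
  (cond5 q gamma Phi /\ exists M, forall j, dual (Psi j) M).
Proof.
rewrite sectional_class; split=> -[rows h]; split=> //.
  exact/(sectional_null_image V_weights (psi_dual rows) V_sectional).
exact: (sectional_null_image V_weights (psi_dual rows) V_sectional).2.
Qed.

End Sectional.

Section Ell1.
Local Notation dual := (dual_ball_of (@one_weights R)).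

Lemma cond1P : bounded_rows (@one_weights R) <-> cond1 q gamma Phi.
Proof.
split=> h j.
  have [Pc [M PM]] := h j; split=> //; apply/ereal_sup_EFin_ltyP.
  by exists M => -[m k] /=; exact: ((one_dualP _ _).1 (PM m)).
have [Pc /ereal_sup_EFin_ltyP[M PM]] := h j; split=> //.
by exists M => m; apply/one_dualP => k; exact: (PM (m, k)).
Qed.

Lemma cond11P : (exists M, forall J : {fset nat},
    dual (fun k => \sum_(j <- J) Psi j k) M) <-> cond11 q gamma Phi.
Proof.
rewrite /cond11 ereal_sup_ltyP; split=> -[M PM]; exists M => J.
  by apply: ge_ereal_sup => _ [k _ <-]; rewrite lee_fin; exact: ((one_dualP _ _).1 (PM J)).
apply/one_dualP => k; rewrite -lee_fin; apply: le_trans (PM J).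
by apply: ereal_sup_ubound; exists k.
Qed.

Lemma cond13P : (exists M, forall j, dual (Psi j) M) <-> cond13 q gamma Phi.
Proof.
rewrite /cond13 ereal_sup_EFin_ltyP; split=> -[M PM]; exists M.
  by move=> [j k] /=; exact: ((one_dualP _ _).1 (PM j)).
by move=> j; apply/one_dualP => k; exact: (PM (j, k)).
Qed.

End Ell1.

Section Ellp.
Variables p p' : R.
Hypotheses (p_gt0 : 0 < p) (p'_gt0 : 0 < p') (pp' : p^-1 + p'^-1 = 1).
Local Notation dual := (dual_ball_of (lp_weights p')).

Lemma cond2P : bounded_rows (lp_weights p') <-> cond2 q gamma p' Phi.
Proof.
have sumE j m n : \sum_(0 <= k < n) normc (P j m k) `^ p' <=
    \sum_(0 <= k < m.+1) normc (P j m k) `^ p'.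
  rewrite -lee_fin -(nneseries_fin (n := m.+1)); first 1 last.
  - by move=> k; exact: powR_ge0.
  - by move=> k mk; rewrite psi_part0// normc0 powR0 ?gt_eqF.
  rewrite -sumEFin; apply: nneseries_lim_ge => k _ _; rewrite lee_fin.
  exact: powR_ge0.
split=> h j.
  have [Pc /(lp_uniform_dualP p_gt0 p'_gt0 pp')[M PM]] := h j; split=> //.
  by apply/ereal_sup_EFin_ltyP; exists M => m; exact: PM.
have [Pc /ereal_sup_EFin_ltyP[M PM]] := h j; split=> //.
apply/(lp_uniform_dualP p_gt0 p'_gt0 pp'); exists M => m n.
exact: le_trans (PM m).
Qed.

Lemma cond10P : (exists M, forall j, dual (Psi j) M) <-> cond10 q gamma p' Phi.
Proof.
rewrite (lp_uniform_dualP p_gt0 p'_gt0 pp') /cond10 ereal_sup_nneseries_ltyP//.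
by move=> j k; exact: powR_ge0.
Qed.

Lemma cond12P : (exists M, forall J : {fset nat},
    dual (fun k => \sum_(j <- J) Psi j k) M) <-> cond12 q gamma p' Phi.
Proof.
rewrite (lp_uniform_dualP p_gt0 p'_gt0 pp') /cond12 ereal_sup_nneseries_ltyP//.
by move=> j k; exact: powR_ge0.
Qed.

End Ellp.

Section EllInfty.
Local Notation ell1_bound a M := (forall n, \sum_(0 <= k < n) normc (a k) <= M).
Local Notation dual := (dual_ball_of (@sup_weights R)).
Local Notation W := (@sup_weights_weights R).

Let P_total j m : total (P j m) = (\sum_(0 <= k < m.+1) normc (P j m k))%:E.
Proof.
apply: nneseries_fin => k; first exact: normc_ge0.
by move=> mk; rewrite psi_part0// normc0.
Qed.

Let P_ell1 j m : exists M, ell1_bound (P j m) M.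
Proof.
exists (\sum_(0 <= k < m.+1) normc (P j m k)); apply/nneseries_leP.
  by move=> k; exact: normc_ge0.
by rewrite -P_total.
Qed.

(** The condition [cond3], with the convergence of the moduli sums replaced by
    convergence of the rows in [l_1]. *)
Definition ell1_rows := forall j, [/\ exists M, ell1_bound (Psi j) M,
  forall k, cvgn (fun m => P j m k) & ell1_cvg (P j) (Psi j)].

Let ell1_rowsP :
  (forall j h, space_of (@sup_weights R) h -> cvgn (fun m => pairing (P j m) h))
  <-> ell1_rows.
Proof.
split=> h j.
  have [b [bM Pb Pbl]] := (bounded_convergent_image (P_ell1 j)).1 (h j).
  have -> : Psi j = b.
    by apply/funext => k; exact: (cvg_lim _ (Pb k)).
  split; [exact: bM|move=> k|exact: Pbl].
  by apply/cvg_ex; exists (b k); exact: Pb.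
have [PM Pc Pl] := h j; apply: (bounded_convergent_image (P_ell1 j)).2.
by exists (Psi j); split=> // k; exact: psi_cvg.
Qed.

Lemma cond3P : ell1_rows <-> cond3 q gamma Phi.
Proof.
split=> h j; have [h1 h2 h3] := h j.
  have [M PM] := h1; have := ell1_cvg_total (P_ell1 j) PM h3.
  under eq_fun do rewrite P_total.
  split=> //; apply/nneseries_ltyP; last by exists M.
  by move=> k; exact: normc_ge0.
have [M PM] : exists M, ell1_bound (Psi j) M.
  by apply/nneseries_ltyP => // k; exact: normc_ge0.
split=> //; first by exists M.
apply: (total_cvg_ell1 (P_ell1 j) _ PM) => [k|]; first exact: psi_cvg.
by under eq_fun do rewrite P_total.
Qed.

Let bounded_class Y : class (@ell_infty R) Y <-> cond3 q gamma Phi /\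
  forall h, space_of (@sup_weights R) h -> Y (fun j => pairing (Psi j) h).
Proof.
have Plim j : (forall h, space_of (@sup_weights R) h ->
      cvgn (fun m => pairing (P j m) h)) ->
    forall h, space_of (@sup_weights R) h ->
    (fun m => pairing (P j m) h) @ \oo --> pairing (Psi j) h.
  move=> Pc h hX.
  have [b [[M bM] Pb Pbl]] := (bounded_convergent_image (P_ell1 j)).1 Pc.
  have -> : Psi j = b by apply/funext => k; exact: (cvg_lim _ (Pb k)).
  exact: (ell1_cvg_pairing (P_ell1 j) bM Pbl).
apply: (iff_trans (mx_class_psiP q_gt0 q_lt1 Y (@ell_infty_space R) Plim)).
by split=> -[rows h]; split=> //; [apply/cond3P|]; apply/ell1_rowsP => //; apply/cond3P.
Qed.

Let psi_ell1 : cond3 q gamma Phi -> forall j, exists M, ell1_bound (Psi j) M.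
Proof. by move=> /cond3P h j; have [] := h j. Qed.

Let psi_dual : cond3 q gamma Phi -> forall j, exists M, dual (Psi j) M.
Proof. by move=> h j; have [M PM] := psi_ell1 h j; exists M; exact/sup_dualP. Qed.

Lemma bounded_class_ell1 : class (@ell_infty R) (ell 1) <->
  cond3 q gamma Phi /\ cond4 q gamma Phi.
Proof.
have -> : cond4 q gamma Phi <-> exists M, forall J : {fset nat},
    dual (fun k => \sum_(j <- J) Psi j k) M.
  rewrite /cond4 ereal_sup_nneseries_ltyP; last by move=> *; exact: normc_ge0.
  by split=> -[M h]; exists M => J; apply/sup_dualP; exact: h.
rewrite bounded_class; split=> -[rows h]; split=> //.
  by apply/(summable_image W (psi_dual rows)) => x /h/ell1P.
move=> x xX; apply/ell1P; exact: ((summable_image W (psi_dual rows)).2 h).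
Qed.

Lemma bounded_class_ell_infty : class (@ell_infty R) (@ell_infty R) <->
  cond3 q gamma Phi /\ cond7 q gamma Phi.
Proof.
have -> : cond7 q gamma Phi <-> exists M, forall j, dual (Psi j) M.
  rewrite /cond7 ereal_sup_nneseries_ltyP; last by move=> *; exact: normc_ge0.
  by split=> -[M h]; exists M => J; apply/sup_dualP; exact: h.
rewrite bounded_class; split=> -[rows h]; split=> //.
  by apply/(bounded_image W (psi_dual rows)) => x /h/ell_inftyP.
move=> x xX; apply/ell_inftyP; exact: ((bounded_image W (psi_dual rows)).2 h).
Qed.

Lemma bounded_class_null : class (@ell_infty R) (@null_seq R) <->
  cond3 q gamma Phi /\ cond8 q gamma Phi.
Proof.
rewrite bounded_class; split=> -[rows h]; split=> //.
  exact/(total_cvg0 (psi_ell1 rows))/(bounded_null_image (psi_ell1 rows)).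
apply: (bounded_null_image (psi_ell1 rows)).2.
exact/(total_cvg0 (psi_ell1 rows)).
Qed.

Lemma bounded_class_conv : class (@ell_infty R) (@conv_seq R) <->
  cond3 q gamma Phi /\ cond6 q gamma Phi /\ cond9 q gamma Phi.
Proof.
rewrite bounded_class; split=> [[rows h]|[rows [c6 [c9 c9y]]]]; split=> //.
  have [b [[M bM] Pb Pbl]] := (bounded_convergent_image (psi_ell1 rows)).1 h.
  split; first by move=> k; exact: cvgP (Pb k).
  have bE : (fun k => limn (fun j => Psi j k)) = b.
    by apply/funext => k; exact: (cvg_lim _ (Pb k)).
  rewrite /cond9 -[X in (X < _)%E]/(total (fun k => limn (fun j => Psi j k))).
  rewrite -[X in _ --> X]/(total (fun k => limn (fun j => Psi j k))) bE.
  split; first exact: (ell1_cvg_total (psi_ell1 rows) bM Pbl).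
  by apply/nneseries_ltyP; [move=> k; exact: normc_ge0|exists M].
apply: (bounded_convergent_image (psi_ell1 rows)).2.
have [M bM] : exists M, ell1_bound (fun k => limn (fun j => Psi j k)) M.
  by apply/nneseries_ltyP => // k; exact: normc_ge0.
exists (fun k => limn (fun j => Psi j k)); split=> //; first by exists M.
exact: (total_cvg_ell1 (psi_ell1 rows) _ bM).
Qed.

End EllInfty.

End MatrixClasses.

Local Close Scope classical_set_scope.
Local Close Scope complex_scope.

Theorem lemma4p1 (R : realType) (q gamma p p' : R) (Phi : nat -> nat -> R[i])
  (hq0 : 0 < q) (hq1 : q < 1) (hgamma : 0 < gamma)
  (hp : 1 < p) (hpp' : p^-1 + p'^-1 = 1) :
  (mx_class (nabla_domain q gamma (ell 1)) (ell 1) Phi <->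
     cond1 q gamma Phi /\ cond11 q gamma Phi) /\
  (mx_class (nabla_domain q gamma (ell 1)) (@null_seq R) Phi <->
     cond1 q gamma Phi /\ cond5 q gamma Phi /\ cond13 q gamma Phi) /\
  (mx_class (nabla_domain q gamma (ell 1)) (@conv_seq R) Phi <->
     cond1 q gamma Phi /\ cond6 q gamma Phi /\ cond13 q gamma Phi) /\
  (mx_class (nabla_domain q gamma (ell 1)) (@ell_infty R) Phi <->
     cond1 q gamma Phi /\ cond13 q gamma Phi) /\
  (mx_class (nabla_domain q gamma (ell p)) (ell 1) Phi <->
     cond2 q gamma p' Phi /\ cond12 q gamma p' Phi) /\
  (mx_class (nabla_domain q gamma (ell p)) (@null_seq R) Phi <->
     cond2 q gamma p' Phi /\ cond5 q gamma Phi /\ cond10 q gamma p' Phi) /\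
  (mx_class (nabla_domain q gamma (ell p)) (@conv_seq R) Phi <->
     cond2 q gamma p' Phi /\ cond6 q gamma Phi /\ cond10 q gamma p' Phi) /\
  (mx_class (nabla_domain q gamma (ell p)) (@ell_infty R) Phi <->
     cond2 q gamma p' Phi /\ cond10 q gamma p' Phi) /\
  (mx_class (nabla_domain q gamma (@ell_infty R)) (ell 1) Phi <->
     cond3 q gamma Phi /\ cond4 q gamma Phi) /\
  (mx_class (nabla_domain q gamma (@ell_infty R)) (@null_seq R) Phi <->
     cond3 q gamma Phi /\ cond8 q gamma Phi) /\
  (mx_class (nabla_domain q gamma (@ell_infty R)) (@conv_seq R) Phi <->
     cond3 q gamma Phi /\ cond6 q gamma Phi /\ cond9 q gamma Phi) /\
  (mx_class (nabla_domain q gamma (@ell_infty R)) (@ell_infty R) Phi <->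
     cond3 q gamma Phi /\ cond7 q gamma Phi).

Proof.
have p_gt0 : 0 < p by exact: lt_trans hp.
have p'_gt0 : 0 < p'.
  rewrite -invr_gt0.
  have -> : p'^-1 = 1 - p^-1 by rewrite -hpp' addrAC subrr add0r.
  by rewrite subr_gt0 invf_lt1.
pose W1 := @one_weights_weights R.
pose S1 := @one_sectional R.
pose X1 := @ell1_space R.
have Wp := @lp_weights_weights R p' p'_gt0.
have Sp := @lp_sectional R p p' p_gt0 p'_gt0 hpp'.
have Xp := @ell_space R p p' p_gt0 p'_gt0 hpp'.
pose c2 := @cond2P R q gamma Phi p p' p_gt0 p'_gt0 hpp'.
pose c10 := @cond10P R q gamma Phi p p' p_gt0 p'_gt0 hpp'.
pose c12 := @cond12P R q gamma Phi p p' p_gt0 p'_gt0 hpp'.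
rewrite -cond1P -cond11P -cond13P -c2 -c10 -c12.
split; first exact: (sectional_class_ell1 gamma Phi hq0 hq1 W1 S1 X1).
split; first exact: (sectional_class_null gamma Phi hq0 hq1 W1 S1 X1).
split; first exact: (sectional_class_conv gamma Phi hq0 hq1 W1 S1 X1).
split; first exact: (sectional_class_ell_infty gamma Phi hq0 hq1 W1 S1 X1).
split; first exact: (sectional_class_ell1 gamma Phi hq0 hq1 Wp Sp Xp).
split; first exact: (sectional_class_null gamma Phi hq0 hq1 Wp Sp Xp).
split; first exact: (sectional_class_conv gamma Phi hq0 hq1 Wp Sp Xp).
split; first exact: (sectional_class_ell_infty gamma Phi hq0 hq1 Wp Sp Xp).
split; first exact: (bounded_class_ell1 gamma Phi hq0 hq1).
split; first exact: (bounded_class_null gamma Phi hq0 hq1).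
split; first exact: (bounded_class_conv gamma Phi hq0 hq1).
exact: (bounded_class_ell_infty gamma Phi hq0 hq1).
Qed.
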